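(* Let $1<\alpha<2$ and $\rho\in[0,1]$, and set $\alpha'=1/\alpha$ and $\rho'=1-(2-\alpha)\rho$. Then for all $x>0$, $$\psi_{\alpha,\rho}(x)=x^{-1-\alpha}\,\psi_{\alpha',\rho'}(x^{-\alpha}).$$
   Context: For a Borel probability measure $\mu$ on $\mathbf{R}$ let $G_\mu(z)=\int_{-\infty}^\infty\frac{1}{z-t}\,d\mu(t)$ and $F_\mu=1/G_\mu$ on $\mathbf{C}^+=\{\Im z>0\}$. For every $\eta>0$ there is $M>0$ such that $F_\mu$ has an analytic inverse $F_\mu^{-1}$ on $\Gamma_{\eta,M}=\{x+iy:y>M,|x|<\eta y\}$ with values in $\mathbf{C}^+$ ($F_\mu(F_\mu^{-1}(z))=z$, $F_\mu^{-1}(z)/z\to1$ as $z\to\infty$). The Voiculescu transform is $\phi_\mu(z)=F_\mu^{-1}(z)-z$; it determines $\mu$. For $0\le\rho\le1$, $\nu_{\alpha,\rho}$ denotes the ($\boxplus$-stable) probability measure on $\mathbf{R}$ whose Voiculescu transform is $e^{i(\alpha-2)\rho\pi}z^{1-\alpha}$ if $1<\alpha<2$, and $-e^{i\alpha\rho\pi}z^{1-\alpha}$ if $0<\alpha<1$ (principal branches on $\mathbf{C}^+$). Each of these measures is absolutely continuous with respect to Lebesgue measure, and $\psi_{\alpha,\rho}$ denotes its continuous density on $\mathbf{R}$ (equal to $0$ outside the support). *)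

(* Defs.v *)
From HB Require Import structures.
From mathcomp Require Import all_boot all_order all_algebra.
From mathcomp Require Import complex.
From mathcomp Require Import all_classical all_reals all_analysis.
Set Implicit Arguments.
Unset Strict Implicit.
Unset Printing Implicit Defensive.
Import Order.TTheory GRing.Theory Num.Theory.
Import numFieldNormedType.Exports.
Local Open Scope classical_set_scope.
Local Open Scope ring_scope.
Local Open Scope complex_scope.

Definition cexp (R : realType) (z : R[i]) : R[i] :=
  (expR (complex.Re z))%:C * (cos (complex.Im z) +i* sin (complex.Im z)).

(* The argument in ]-pi, pi]; on the open upper half-plane it lies in ]0, pi[.
   The value at 0 is irrelevant. *)
Definition carg (R : realType) (z : R[i]) : R :=
  let t := acos (complex.Re z / Normc.normc z) in
  if 0 <= complex.Im z then t else - t.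

Definition clog (R : realType) (z : R[i]) : R[i] :=
  ln (Normc.normc z) +i* carg z.

Definition cpow (R : realType) (z : R[i]) (s : R) : R[i] :=
  cexp (s%:C * clog z).

Definition upper_half_plane (R : realType) : set R[i] :=
  [set z | 0 < complex.Im z].

Definition Gamma (R : realType) (eta M : R) : set R[i] :=
  [set z | M < complex.Im z /\ `|complex.Re z| < eta * complex.Im z].

(* Complex differentiability on an open set; [R[i]^o] is [R[i]] as a normed
   space over itself. *)
Definition holomorphic_on (R : realType) (D : set R[i]) (f : R[i] -> R[i]) :=
  forall z, D z -> derivable (f : R[i]^o -> R[i]^o) z 1.

(* The integral of 1 / (z - t) d mu(t), by real and imaginary parts. *)
Definition cauchy_transform (R : realType)
    (mu : probability (measurableTypeR R) R) (z : R[i]) : R[i] :=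
  (\int[mu]_(t in setT) complex.Re (z - t%:C)^-1) +i*
  (\int[mu]_(t in setT) complex.Im (z - t%:C)^-1).

Definition F_transform (R : realType)
    (mu : probability (measurableTypeR R) R) (z : R[i]) : R[i] :=
  (cauchy_transform mu z)^-1.

(* [H] is the analytic inverse of [F_transform mu] on [Gamma eta M]; the last
   clause says that H(z) / z -> 1 as z -> oo in [Gamma eta M]. *)
Definition is_F_inverse (R : realType)
    (mu : probability (measurableTypeR R) R) (eta M : R) (H : R[i] -> R[i]) :=
  [/\ holomorphic_on (Gamma eta M) H,
      forall z, Gamma eta M z -> upper_half_plane (H z),
      forall z, Gamma eta M z -> F_transform mu (H z) = z &
      forall e : R, 0 < e -> exists A : R, forall z, Gamma eta M z ->
        A < Normc.normc z -> Normc.normc (H z / z - 1) < e].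

(* The Voiculescu transform is only defined on regions [Gamma eta M] with [M]
   large depending on [eta], whereas [phi] is a total function: the values of
   [phi] outside of these regions are unconstrained. *)
Definition is_voiculescu_transform (R : realType)
    (mu : probability (measurableTypeR R) R) (phi : R[i] -> R[i]) :=
  forall eta : R, 0 < eta -> exists2 M : R, 0 < M &
    exists2 H : R[i] -> R[i], is_F_inverse mu eta M H &
      forall z, Gamma eta M z -> phi z = H z - z.

(* Meaningful for alpha in ]0, 1[ or ]1, 2[ and rho in [0, 1]; the second branch
   is the case 0 < alpha < 1. *)
Definition stable_voiculescu (R : realType) (alpha rho : R) (z : R[i]) : R[i] :=
  if 1 < alpha then
    cexp (0 +i* ((alpha - 2) * rho * pi)) * cpow z (1 - alpha)
  else
    - cexp (0 +i* (alpha * rho * pi)) * cpow z (1 - alpha).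

Definition is_free_stable (R : realType) (alpha rho : R)
    (nu : probability (measurableTypeR R) R) :=
  is_voiculescu_transform nu (stable_voiculescu alpha rho).

(* The continuous Lebesgue density of [nu]. It is unique, and by continuity it
   vanishes outside of the (closed) support of [nu]. *)
Definition is_continuous_density (R : realType)
    (nu : probability (measurableTypeR R) R) (psi : R -> R) :=
  [/\ continuous psi, forall x, 0 <= psi x &
      forall A : set (measurableTypeR R), measurable A ->
        (nu A = \int[lebesgue_measure]_(x in A) (psi x)%:E)%E].

(* Main.v *)
Require Import Defs.
From HB Require Import structures.
From mathcomp Require Import all_boot all_order all_algebra.
From mathcomp Require Import complex.
From mathcomp Require Import all_classical all_reals all_analysis.
From mathcomp Require Import measurable_realfun ring lra.
Import Order.TTheory GRing.Theory Num.Theory.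
Import numFieldNormedType.Exports.
Set Implicit Arguments.
Unset Strict Implicit.
Unset Printing Implicit Defensive.
Local Open Scope classical_set_scope.
Local Open Scope ring_scope.
Local Open Scope complex_scope.

Local Notation cabs := Normc.normc.
Local Notation Re := (@complex.Re _).
Local Notation Im := (@complex.Im _).

(** Write G and G' for the Cauchy transforms of nu and nu', F = 1 / G and
    F' = 1 / G'. The inverses of F and F' that the Voiculescu transforms prescribe
    are K w = w + c w^(1 - alpha), where c = exp (i (alpha - 2) rho pi), and
    K' w = w - exp (i alpha' rho' pi) w^(1 - alpha'). The duality is the relation
        z G'(z) = 1 - Z G(Z),   Z = z^(- 1 / alpha),   Im z > 0
    ([cauchy_relation]), in which Z lies in the lower half-plane. When z tends
    to x^(- alpha), Z tends to x from below; the imaginary parts become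
    - pi x^(- alpha) psi'(x^(- alpha)) on the left and - pi x psi(x) on the
    right by [stieltjes_inversion], G being bounded on bounded sets
    ([cauchy_bounded]). This is the claim.

    The relation is algebraic. The equation K (F z) = z reads
    z G - 1 = c G^alpha, and solving it for G^alpha shows that
    w = z / (1 - Z G(Z)) satisfies K' w = z ([stable_inverse_at]); the powers are
    principal because log w, computed from log z and log F, has its imaginary
    part in the right range.

    The hypotheses speak of F (K w) = w and F' (K' w) = w near infinity only,
    and two analytic continuations are made. First, K w = z has a solution near
    every z close to iM with M large, by the maximum principle applied to
    1 / (K w - z); it has to be F z, and K (F z) = z is continued from there to
    the whole half-plane ([F_functional_equation]). Secondly, z near iM makes
    Z small, hence w close to z, hence F' z = w, and the relation is continued
    in the same way. The continuation principle is [identity_upper]: a function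
    that vanishes near iM for all large M vanishes, because the discs
    |z - iM| < M exhaust the half-plane. On a disc it follows from the maximum
    principle for f(z) / (z - c)^n on annuli.

    The maximum principle is proved for functions that have at every point a
    second-order expansion f(z + h) = f(z) + a h + b h^2 + O(h^3) ([jet2]): at an
    interior maximum of |f|^2 + eps |z|^2, averaging over h = s, -s, is, -is
    cancels all first- and second-order terms except |a|^2 s^2 and eps s^2.
    Sums, products, composites, inverses, exponentials, logarithms, powers and
    Cauchy transforms have such expansions by direct estimates. *)

(** * Modulus and coordinates of complex numbers *)

Section Modulus.
Variable R : realType.
Implicit Types z w : R[i].

Lemma cabs_sqr z : cabs z ^+ 2 = Re z ^+ 2 + Im z ^+ 2.
Proof. by case: z => a b /=; rewrite sqr_sqrtr // addr_ge0 ?sqr_ge0. Qed.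

Lemma cabs_ge0 z : 0 <= cabs z.
Proof. by case: z => a b; exact: sqrtr_ge0. Qed.

Lemma cabs0 : cabs (0 : R[i]) = 0.
Proof. exact: Normc.normc0. Qed.

Lemma cabs_eq0 z : (cabs z == 0) = (z == 0).
Proof.
by apply/eqP/eqP => [/Normc.eq0_normc //|->]; exact: cabs0.
Qed.

Lemma cabs_gt0 z : (0 < cabs z) = (z != 0).
Proof. by rewrite lt0r cabs_ge0 andbT cabs_eq0. Qed.

Lemma cabsX z n : cabs (z ^+ n) = cabs z ^+ n.
Proof.
elim: n => [|n IHn]; first by rewrite !expr0 Normc.normc1.
by rewrite !exprS Normc.normcM IHn.
Qed.

Lemma cabs_real (r : R) : cabs (r%:C) = `|r|.
Proof. by rewrite /= expr0n /= addr0 sqrtr_sqr. Qed.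

Lemma ler_cabsB z w : cabs (z - w) <= cabs z + cabs w.
Proof. by rewrite (le_trans (le_normcD _ _)) // normcN. Qed.

Lemma cabsBC z w : cabs (z - w) = cabs (w - z).
Proof. by rewrite -normcN opprB. Qed.

Lemma ler_cabs_sub z w : cabs z - cabs w <= cabs (z - w).
Proof. by rewrite lerBlDr; have := le_normcD (z - w) w; rewrite subrK. Qed.

Lemma Re_le_cabs z : `|Re z| <= cabs z.
Proof.
rewrite -(@ler_pXn2r _ 2) ?nnegrE ?cabs_ge0 // cabs_sqr real_normK ?num_real //.
by rewrite lerDl sqr_ge0.
Qed.

Lemma Im_le_cabs z : `|Im z| <= cabs z.
Proof.
rewrite -(@ler_pXn2r _ 2) ?nnegrE ?cabs_ge0 // cabs_sqr real_normK ?num_real //.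
by rewrite lerDr sqr_ge0.
Qed.

Lemma cabs_le_ReIm z : cabs z <= `|Re z| + `|Im z|.
Proof.
rewrite -(@ler_pXn2r _ 2) ?nnegrE ?cabs_ge0 ?addr_ge0 // cabs_sqr.
rewrite sqrrD !real_normK ?num_real // -addrA [X in _ <= _ + X]addrC addrA.
by rewrite lerDl mulrn_wge0 // mulr_ge0.
Qed.

Lemma cabs_conj z : cabs (conjc z) = cabs z.
Proof. by case: z => a b /=; rewrite sqrrN. Qed.

Lemma cabs_i : cabs ('i%C : R[i]) = 1.
Proof. by rewrite /= expr0n /= add0r expr1n sqrtr1. Qed.

Lemma complexP z w : Re z = Re w -> Im z = Im w -> z = w.
Proof. by case: z w => [a b] [c d] /= -> ->. Qed.

Lemma cReD z w : Re (z + w) = Re z + Re w. Proof. by case: z w => [a b] [c d]. Qed.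
Lemma cImD z w : Im (z + w) = Im z + Im w. Proof. by case: z w => [a b] [c d]. Qed.
Lemma cReN z : Re (- z) = - Re z. Proof. by case: z. Qed.
Lemma cImN z : Im (- z) = - Im z. Proof. by case: z. Qed.
Lemma cReM z w : Re (z * w) = Re z * Re w - Im z * Im w.
Proof. by case: z w => [a b] [c d]. Qed.
Lemma cImM z w : Im (z * w) = Re z * Im w + Im z * Re w.
Proof. by case: z w => [a b] [c d] /=. Qed.
Lemma cReC (r : R) : Re r%:C = r. Proof. by []. Qed.
Lemma cImC (r : R) : Im r%:C = 0. Proof. by []. Qed.
Lemma cRe_conj z : Re (conjc z) = Re z. Proof. by case: z. Qed.
Lemma cIm_conj z : Im (conjc z) = - Im z. Proof. by case: z. Qed.
Lemma conjcD z w : conjc (z + w) = conjc z + conjc w.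
Proof. exact: rmorphD. Qed.
Lemma conjcM z w : conjc (z * w) = conjc z * conjc w.
Proof. exact: rmorphM. Qed.
Lemma cRe1 : Re (1 : R[i]) = 1. Proof. by []. Qed.
Lemma cIm1 : Im (1 : R[i]) = 0. Proof. by []. Qed.
Lemma cRei : Re ('i%C : R[i]) = 0. Proof. by []. Qed.
Lemma cImi : Im ('i%C : R[i]) = 1. Proof. by []. Qed.
Definition ReImE := (cRe1, cIm1, cRei, cImi, cReD, cImD, cReN, cImN, cReM, cImM, cReC, cImC, cRe_conj, cIm_conj).

Lemma Im_neq0 z : Im z != 0 -> z != 0.
Proof. by apply: contraNneq => ->. Qed.

End Modulus.

(** * Second-order expansions *)

Section BigO.
Variable R : realType.
Implicit Types (e f : R[i] -> R[i]) (m n : nat).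

Definition isO n e := exists C d : R,
  [/\ 0 <= C, 0 < d & forall h, cabs h < d -> cabs (e h) <= C * cabs h ^+ n].

Lemma eq_isO n e f (d : R) : 0 < d -> (forall h, cabs h < d -> e h = f h) ->
  isO n f -> isO n e.
Proof.
move=> d0 ef [C [d' [C0 d'0 H]]]; exists C, (Num.min d d').
split=> // [|h]; first by rewrite lt_min d0.
by rewrite lt_min => /andP[hd hd']; rewrite ef // H.
Qed.

Lemma isO_ext n e f : e =1 f -> isO n f -> isO n e.
Proof. by move=> ef; apply: (@eq_isO _ _ _ 1) => // h _. Qed.

Lemma isO_add n e f : isO n e -> isO n f -> isO n (fun h => e h + f h).
Proof.
move=> [C [d [C0 d0 H]]] [C' [d' [C'0 d'0 H']]]; exists (C + C'), (Num.min d d').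
split=> [||h]; [exact: addr_ge0|by rewrite lt_min d0|].
rewrite lt_min => /andP[hd hd']; rewrite mulrDl.
by rewrite (le_trans (le_normcD _ _)) // lerD // ?H ?H'.
Qed.

Lemma isO_mul m n e f : isO m e -> isO n f -> isO (m + n) (fun h => e h * f h).
Proof.
move=> [C [d [C0 d0 H]]] [C' [d' [C'0 d'0 H']]]; exists (C * C'), (Num.min d d').
split=> [||h]; [exact: mulr_ge0|by rewrite lt_min d0|].
rewrite lt_min => /andP[hd hd']; rewrite exprD mulrACA Normc.normcM.
by rewrite ler_pM ?cabs_ge0 // ?H ?H'.
Qed.

Lemma isO_weak m n e : (m <= n)%N -> isO n e -> isO m e.
Proof.
move=> mn [C [d [C0 d0 H]]]; exists C, (Num.min d 1).
split=> // [|h]; first by rewrite lt_min d0 /=.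
rewrite lt_min => /andP[hd h1]; rewrite (le_trans (H _ hd)) // ler_wpM2l //.
by rewrite ler_wiXn2l ?cabs_ge0 // ltW.
Qed.

Lemma isO_cst c : isO 0 (fun=> c).
Proof.
by exists (cabs c), 1; split=> // [|h _]; rewrite ?cabs_ge0 // expr0 mulr1.
Qed.

Lemma isO_id : isO 1 id.
Proof. by exists 1, 1; split=> // h _; rewrite mul1r expr1. Qed.

Lemma isO_scale n c e : isO n e -> isO n (fun h => c * e h).
Proof. by move=> He; have := isO_mul (isO_cst c) He; rewrite add0n. Qed.

Lemma isO_opp n e : isO n e -> isO n (fun h => - e h).
Proof. by move=> /(isO_scale (-1)); apply: isO_ext => h; rewrite mulN1r. Qed.

Lemma isO_comp n e f : isO n.+1 e -> isO 1 f -> isO n.+1 (e \o f).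
Proof.
move=> [C [d [C0 d0 H]]] [C' [d' [C'0 d'0 H']]].
have C'1 : 0 < C' + 1 by rewrite ltr_pwDr.
exists (C * (C' + 1) ^+ n.+1), (Num.min d' (d / (C' + 1))).
split=> [||h]; first by rewrite mulr_ge0 // exprn_ge0 // ltW.
  by rewrite lt_min d'0 divr_gt0.
rewrite lt_min => /andP[hd' hd].
have fh : cabs (f h) <= (C' + 1) * cabs h.
  by have := H' _ hd'; have := cabs_ge0 h; rewrite expr1; nra.
have fhd : cabs (f h) < d.
  by rewrite (le_lt_trans fh) // mulrC -ltr_pdivlMr.
rewrite /= (le_trans (H _ fhd)) // -mulrA ler_wpM2l // -exprMn.
by rewrite lerXn2r ?nnegrE ?cabs_ge0 // mulr_ge0 ?cabs_ge0 // ltW.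
Qed.

Lemma isO_poly n m (c : R[i]) : (n <= m)%N -> isO n (fun h => c * h ^+ m).
Proof.
move=> nm; apply: (isO_weak nm); apply: isO_scale.
elim: m {nm} => [|m IHm]; first by apply: isO_ext (isO_cst 1) => h; exact: expr0.
by have := isO_mul isO_id IHm; apply: isO_ext => h; rewrite exprS.
Qed.

(** Twofold differentiability in the weakest form that serves the maximum
    principle; the cubic remainder makes all closure properties products of
    [isO] bounds. *)
Definition jet2 e (z : R[i]) := exists a b : R[i],
  isO 3 (fun h => e (z + h) - (e z + a * h + b * h ^+ 2)).

Lemma jet2_cst c z : jet2 (fun=> c) z.
Proof.
exists 0, 0; apply: (isO_ext (f := fun h => 0 * h ^+ 3)) (isO_poly _ _) => // h.
by ring.
Qed.

Lemma jet2_id z : jet2 id z.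
Proof.
exists 1, 0; apply: (isO_ext (f := fun h => 0 * h ^+ 3)) (isO_poly _ _) => // h /=.
by ring.
Qed.

Lemma jet2_O1 e z : jet2 e z -> isO 1 (fun h => e (z + h) - e z).
Proof.
move=> [a [b H]].
apply: (isO_ext (f := fun h => (e (z + h) - (e z + a * h + b * h ^+ 2)) +
   (a * h ^+ 1 + b * h ^+ 2))); first by move=> h; ring.
by apply: isO_add; [exact: isO_weak H|apply: isO_add; exact: isO_poly].
Qed.

Lemma jet2_add e f z : jet2 e z -> jet2 f z -> jet2 (fun w => e w + f w) z.
Proof.
move=> [a [b H]] [a' [b' H']]; exists (a + a'), (b + b').
by apply: isO_ext (isO_add H H') => h; ring.
Qed.

Lemma jet2_mul e f z : jet2 e z -> jet2 f z -> jet2 (fun w => e w * f w) z.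
Proof.
move=> [a [b H]] Hf; have [a' [b' H']] := Hf.
exists (a * f z + e z * a'), (b * f z + a * a' + e z * b').
have O0 : isO 0 (fun h => f (z + h)).
  apply: (isO_ext (f := fun h => (f (z + h) - f z) + f z)) => [h|]; first by ring.
  apply: isO_add (isO_cst _); exact: isO_weak (jet2_O1 Hf).
pose p h := e z + a * h + b * h ^+ 2.
have Op : isO 0 p.
  apply: (isO_ext (f := fun h => e z + (a * h ^+ 1 + b * h ^+ 2))) => [h|].
    by rewrite /p; ring.
  by apply: isO_add (isO_cst _) _; apply: isO_add; exact: isO_poly.
apply: (isO_ext (f := fun h =>
  (e (z + h) - p h) * f (z + h) +
  (p h * (f (z + h) - (f z + a' * h + b' * h ^+ 2)) +
   ((a * b' + b * a') * h ^+ 3 + b * b' * h ^+ 4)))) => [h|].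
  by rewrite /p; ring.
apply: isO_add; first by have := isO_mul H O0; rewrite addn0.
apply: isO_add; first by have := isO_mul Op H'; rewrite add0n.
by apply: isO_add; exact: isO_poly.
Qed.

Lemma jet2_exp e n z : jet2 e z -> jet2 (fun w => e w ^+ n) z.
Proof.
move=> He; elim: n => [|n IHn]; first exact: jet2_cst.
have [a [b H]] := jet2_mul He IHn; exists a, b.
by apply: isO_ext H => h; rewrite !exprS.
Qed.

Lemma jet2_opp e z : jet2 e z -> jet2 (fun w => - e w) z.
Proof.
move=> H; have [a [b]] := jet2_mul (jet2_cst (-1) z) H.
by move=> H'; exists a, b; apply: isO_ext H' => h; rewrite !mulN1r.
Qed.

(** With k = e (z + h) - e z, the new remainder is that of f at k, plus
    a' times that of e, plus b' (k^2 - (a h)^2); the last factors as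
    (k - a h) (k + a h), of order 2 + 1. *)
Lemma jet2_comp e f z : jet2 e z -> jet2 f (e z) -> jet2 (f \o e) z.
Proof.
move=> He [a' [b' H']]; have [a [b H]] := He.
pose k h := e (z + h) - e z.
have O1k : isO 1 k := jet2_O1 He.
exists (a' * a), (a' * b + b' * a ^+ 2).
have O2 : isO 2 (fun h => k h - a * h).
  apply: (isO_ext (f := fun h => (e (z + h) - (e z + a * h + b * h ^+ 2)) +
     b * h ^+ 2)) => [h|]; first by rewrite /k; ring.
  by apply: isO_add (isO_poly _ _) => //; exact: isO_weak H.
have O1 : isO 1 (fun h => k h + a * h).
  by apply: isO_add => //; apply: isO_ext (isO_poly a (leqnn 1)).
apply: (isO_ext (f := fun h =>
  (((fun l => f (e z + l) - (f (e z) + a' * l + b' * l ^+ 2)) \o k) h) +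
  (a' * (e (z + h) - (e z + a * h + b * h ^+ 2)) +
   b' * ((k h - a * h) * (k h + a * h))))) => [h|].
  rewrite /= (_ : e z + k h = e (z + h)); last by rewrite /k; ring.
  by rewrite /k; ring.
apply: isO_add; first exact: isO_comp.
apply: isO_add; first exact: isO_scale.
by apply: isO_scale; exact: (isO_mul O2 O1).
Qed.

(** Truncating the geometric series of 1 / (z + h) leaves - z^-3 h^3 / (z + h). *)
Lemma jet2_inv z : z != 0 -> jet2 (fun w => w^-1) z.
Proof.
move=> z0; exists (- z^-1 ^+ 2), (z^-1 ^+ 3).
have nz : 0 < cabs z by rewrite cabs_gt0.
have zh0 h : cabs h < cabs z / 2 -> cabs z / 2 <= cabs (z + h).
  by move=> hz; have := ler_cabs_sub z (- h); rewrite normcN opprK; lra.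
apply: (@eq_isO _ _ (fun h => (- z^-1 ^+ 3 * h ^+ 3) * (z + h)^-1) (cabs z / 2)).
- by rewrite divr_gt0.
- move=> h /zh0 zh; have : z + h != 0 by rewrite -cabs_gt0 (lt_le_trans _ zh) // divr_gt0.
  by move=> zh'; field; rewrite z0 zh'.
have O0 : isO 0 (fun h => (z + h)^-1).
  exists (cabs z / 2)^-1, (cabs z / 2); split; rewrite ?invr_ge0 ?divr_ge0 ?divr_gt0 ?cabs_ge0 //.
  move=> h /zh0 zh; rewrite expr0 mulr1 Normc.normcV lef_pV2 // posrE ?divr_gt0 //.
  by rewrite (lt_le_trans _ zh) // divr_gt0.
by have := isO_mul (isO_poly (- z^-1 ^+ 3) (leqnn 3)) O0; rewrite addn0.
Qed.

End BigO.

(** * The complex exponential *)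

Section Elementary.
Variable R : realType.
Implicit Types z w : R[i].

(** Integrating a bound by the mean value theorem raises its order by one. *)
Lemma taylor_step (F f : R -> R) (M : R) (n : nat) :
  (forall x : R, is_derive x 1 F (f x)) -> F 0 = 0 ->
  (forall x, `|x| <= 1 -> `|f x| <= M * `|x| ^+ n) ->
  forall x, `|x| <= 1 -> `|F x| <= M * `|x| ^+ n.+1.
Proof.
move=> dF F0 fM x x1.
have cF a b : {within `[a, b], continuous F}.
  apply: continuous_subspaceT => y.
  by apply/differentiable_continuous/derivable1_diffP; case: (dF y).
have [c cx Fx] : exists2 c, `|c| <= `|x| & F x = f c * x.
  have [x0|x0] := leP 0 x.
    have [c] := MVT_segment x0 (fun y _ => dF y) (cF 0 x).
    rewrite in_itv /= F0 !subr0 => /andP[c0 cx] ->; exists c => //.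
    by rewrite !ger0_norm.
  have [c] := MVT_segment (ltW x0) (fun y _ => dF y) (cF x 0).
  rewrite in_itv /= F0 !sub0r => /andP[c0 cx] E; exists c.
    by rewrite !ler0_norm ?lerN2 // ltW.
  by apply: oppr_inj; rewrite E mulrN.
have M0 : 0 <= M.
  by have := fM 1; rewrite normr1 expr1n mulr1 => /(_ (lexx _)); apply: le_trans.
rewrite Fx normrM exprSr mulrA ler_wpM2r // (le_trans (fM _ (le_trans cx x1))) //.
by rewrite ler_wpM2l // lerXn2r // nnegrE.
Qed.

Lemma sin_taylor (x : R) : `|x| <= 1 -> `|sin x - x| <= 1 * `|x| ^+ 3.
Proof.
apply: (@taylor_step _ (fun x => cos x - 1)).
- by rewrite ?fctE sin0 subr0.
apply: (@taylor_step _ (fun x => - sin x)).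
- by move=> y; apply: is_derive_eq; rewrite subr0.
- by rewrite ?fctE cos0 subrr.
move=> y y1; rewrite normrN; move: y y1; apply: (@taylor_step _ cos).
- exact: sin0.
by move=> u _; rewrite expr0 mulr1 cos_max.
Qed.

Lemma cos_taylor (x : R) : `|x| <= 1 -> `|cos x - 1 + x ^+ 2 / 2| <= 1 * `|x| ^+ 3.
Proof.
have dF (y : R) : is_derive y 1 (fun x => cos x - 1 + x ^+ 2 / 2) (y - sin y).
  by apply: is_derive_eq; rewrite /GRing.scale /=; field.
apply: (taylor_step dF).
- by rewrite ?fctE cos0 subrr expr0n /= mul0r addr0.
move=> y y1; rewrite distrC (le_trans (sin_taylor y1)) // !mul1r.
by rewrite ler_wiXn2l.
Qed.

Lemma expR_taylor (x : R) : `|x| <= 1 ->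
  `|expR x - 1 - x - x ^+ 2 / 2| <= expR 1 * `|x| ^+ 3.
Proof.
have dF (y : R) : is_derive y 1 (fun x => expR x - 1 - x - x ^+ 2 / 2) (expR y - 1 - y).
  by apply: is_derive_eq; rewrite /GRing.scale /=; field.
apply: (taylor_step dF).
- by rewrite ?fctE expR0 subrr expr0n /= mul0r !subr0.
apply: (@taylor_step _ (fun x => expR x - 1)).
- by move=> y; apply: is_derive_eq; rewrite subr0.
- by rewrite ?fctE expR0 subrr subr0.
apply: (@taylor_step _ expR).
- by move=> y; apply: is_derive_eq; rewrite subr0.
- by rewrite ?fctE expR0 subrr.
move=> y y1; rewrite expr0 mulr1 ger0_norm ?expR_ge0 // ler_expR.
by rewrite (le_trans _ y1) // ler_norm.
Qed.

Lemma isO_real (n : nat) (f : R -> R) (M : R) :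
  (forall x, `|x| <= 1 -> `|f x| <= M * `|x| ^+ n) ->
  (isO n (fun h : R[i] => (f (Re h))%:C) /\ isO n (fun h : R[i] => (f (Im h))%:C)).
Proof.
move=> fM; have M0 : 0 <= M.
  by have := fM 1; rewrite normr1 expr1n mulr1 => /(_ (lexx _)); apply: le_trans.
split; exists M, 1; split=> // h h1; rewrite cabs_real.
  have rh := Re_le_cabs h; rewrite (le_trans (fM _ (le_trans rh (ltW h1)))) //.
  by rewrite ler_wpM2l // lerXn2r ?nnegrE ?cabs_ge0.
have rh := Im_le_cabs h; rewrite (le_trans (fM _ (le_trans rh (ltW h1)))) //.
by rewrite ler_wpM2l // lerXn2r ?nnegrE ?cabs_ge0.
Qed.

Lemma cexpD z w : cexp (z + w) = cexp z * cexp w.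
Proof.
case: z w => [a b] [c d]; rewrite /cexp /= expRD sinD cosD.
by apply: complexP; rewrite /= ; ring.
Qed.

Lemma cexp0 : cexp (0 : R[i]) = 1.
Proof. by rewrite /cexp /= expR0 cos0 sin0 mul1r. Qed.

Lemma cabs_cexp z : cabs (cexp z) = expR (Re z).
Proof.
rewrite /cexp Normc.normcM cabs_real ger0_norm ?expR_ge0 // -[RHS]mulr1.
by congr (_ * _); rewrite /= cos2Dsin2 sqrtr1.
Qed.

Lemma cexp_neq0 z : cexp z != 0.
Proof. by rewrite -cabs_eq0 cabs_cexp gt_eqF // expR_gt0. Qed.

Lemma cexpN z : cexp (- z) = (cexp z)^-1.
Proof.
by apply: (mulIf (cexp_neq0 z)); rewrite mulVf ?cexp_neq0 // -cexpD addNr cexp0.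
Qed.

Lemma conj_cexp z : conjc (cexp z) = cexp (conjc z).
Proof. by case: z => a b; rewrite /cexp /= cosN sinN; apply: complexP => /=; ring. Qed.

Lemma Re_cexp z : Re (cexp z) = expR (Re z) * cos (Im z).
Proof. by rewrite /cexp cReM /= mul0r subr0. Qed.

Lemma Im_cexp z : Im (cexp z) = expR (Re z) * sin (Im z).
Proof. by rewrite /cexp cImM /= mul0r addr0. Qed.

(** Product of the real expansions of exp at Re k and of cos + i sin at Im k;
    the displayed monomials are the terms of order at least 3 that the product
    of the truncated expansions adds to 1 + k + k^2 / 2. *)
Lemma cexp_taylor : isO 3 (fun k : R[i] => cexp k - (1 + k + 2^-1 * k ^+ 2)).
Proof.
have [OE _] := isO_real expR_taylor.
have [_ OS] := isO_real sin_taylor.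
have [_ OC] := isO_real cos_taylor.
have id1 (x : R) : `|x| <= 1 -> `|id x| <= 1 * `|x| ^+ 1 by rewrite mul1r.
have [OA OB] := isO_real id1.
have OAn n : isO n (fun h : R[i] => (Re h)%:C ^+ n).
  elim: n => [|n IHn]; first exact: isO_ext (isO_cst 1).
  by have := isO_mul OA IHn; apply: isO_ext => h; rewrite exprS.
have OBn n : isO n (fun h : R[i] => (Im h)%:C ^+ n).
  elim: n => [|n IHn]; first exact: isO_ext (isO_cst 1).
  by have := isO_mul OB IHn; apply: isO_ext => h; rewrite exprS.
have OP : isO 0 (fun h : R[i] => 1 + (Re h)%:C + 2^-1 * (Re h)%:C ^+ 2).
  apply: isO_add; first by apply: isO_add (isO_cst _) _; apply: isO_weak OA.
  by apply: isO_scale; apply: isO_weak (OAn 2).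
pose CS (h : R[i]) := (cos (Im h) +i* sin (Im h)).
have OCS : isO 0 CS.
  exists 1, 1; split=> // h _; by rewrite /CS /= cos2Dsin2 sqrtr1 expr0 mulr1.
apply: (isO_ext (f := fun h : R[i] =>
  (expR (Re h) - 1 - Re h - Re h ^+ 2 / 2)%:C * CS h +
  ((1 + (Re h)%:C + 2^-1 * (Re h)%:C ^+ 2) *
     ((cos (Im h) - 1 + Im h ^+ 2 / 2)%:C + 'i%C * (sin (Im h) - Im h)%:C) +
   (- 2^-1 * ((Re h)%:C * (Im h)%:C ^+ 2) + (2^-1 * 'i%C * ((Re h)%:C ^+2 * (Im h)%:C) +
     (- 4^-1 * ((Re h)%:C ^+2 * (Im h)%:C ^+ 2))))))) => [h|].
  rewrite /cexp /CS (complexE (cos _ +i* sin _)) /=.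
  move: (Re h) (Im h) (complexE h) => a b ->.
  rewrite !(rmorphB, rmorphD, rmorphM, rmorphXn, rmorph1, fmorphV) /= ?rmorph_nat.
  apply/subr0_eq; rewrite [LHS](_ : _ = - 2^-1 * b%:C ^+ 2 * (1 + 'i%C ^+ 2)); last by field.
  by rewrite sqr_i subrr mulr0.
apply: isO_add; first by have := isO_mul OE OCS; rewrite addn0.
apply: isO_add.
  have := isO_mul OP (isO_add OC (isO_scale 'i%C OS)); rewrite add0n.
  exact: isO_ext.
apply: isO_add; first exact: (isO_scale _ (isO_mul OA (OBn 2))).
apply: isO_add; first exact: (isO_scale _ (isO_mul (OAn 2) OB)).
by apply: isO_scale; apply: (isO_weak _ (isO_mul (OAn 2) (OBn 2))).
Qed.

Lemma jet2_cexp z : jet2 (@cexp R) z.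
Proof.
exists (cexp z), (cexp z * 2^-1).
apply: isO_ext (isO_scale (cexp z) cexp_taylor) => h.
by rewrite cexpD; ring.
Qed.

End Elementary.

(** * Logarithm and powers on the upper half-plane *)

Section Logarithm.
Variable R : realType.
Implicit Types z w : R[i].

Lemma continuous_eps (f : R -> R) x : {for x, continuous f} ->
  forall e, 0 < e -> exists2 d, 0 < d & forall t, `|t - x| < d -> `|f t - f x| < e.
Proof.
move=> cf e e0; have /cvgrPdist_lt /(_ e e0) /nbhs_ballP[d /= d0 H] := cf.
by exists d => // t td; rewrite distrC; apply: H; rewrite /ball /= distrC.
Qed.

Lemma upper_neq0 z : 0 < Im z -> z != 0.
Proof. by move=> z0; apply: Im_neq0; rewrite gt_eqF. Qed.

Lemma upper_cabs_gt0 z : 0 < Im z -> 0 < cabs z.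
Proof. by move=> /upper_neq0; rewrite cabs_gt0. Qed.

Lemma upper_cos_itv z : 0 < Im z -> -1 < Re z / cabs z < 1.
Proof.
move=> z0; have r0 := upper_cabs_gt0 z0.
rewrite -ltr_norml normrM normfV (gtr0_norm r0) ltr_pdivrMr // mul1r.
rewrite -(@ltr_pXn2r _ 2) ?nnegrE ?cabs_ge0 // cabs_sqr real_normK ?num_real //.
by rewrite ltrDl exprn_gt0.
Qed.

Lemma Re_clog z : Re (clog z) = ln (cabs z). Proof. by []. Qed.

Lemma Im_clog z : 0 < Im z -> Im (clog z) = acos (Re z / cabs z).
Proof. by move=> /ltW z0; rewrite /clog /= /carg z0. Qed.

Lemma Im_clog_itv z : 0 < Im z -> 0 < Im (clog z) < pi.
Proof.
move=> z0; rewrite Im_clog //; have /andP[a b] := upper_cos_itv z0.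
by rewrite acos_gt0 ?acos_ltpi // ?a ?b ?(ltW a) ?(ltW b).
Qed.

Lemma cexp_clog z : 0 < Im z -> cexp (clog z) = z.
Proof.
move=> z0; have r0 := upper_cabs_gt0 z0.
have /andP[a b] := upper_cos_itv z0.
apply: complexP; rewrite ?Re_cexp ?Im_cexp Re_clog Im_clog // lnK ?posrE //.
  by rewrite acosK ?in_itv /= ?(ltW a) ?(ltW b) // mulrC divfK // gt_eqF.
rewrite sin_acos ?(ltW a) ?(ltW b) //.
have -> : 1 - (Re z / cabs z) ^+ 2 = (Im z / cabs z) ^+ 2.
  by rewrite !expr_div_n cabs_sqr; field; rewrite -cabs_sqr expf_neq0 // gt_eqF.
by rewrite sqrtr_sqr ger0_norm ?divr_ge0 ?ltW // mulrC divfK // gt_eqF.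
Qed.

Lemma clog_cexp w : 0 < Im w < pi -> clog (cexp w) = w.
Proof.
move=> /andP[w0 wpi]; have Im0 : 0 < Im (cexp w).
  by rewrite Im_cexp mulr_gt0 ?expR_gt0 // sin_gt0_pi // w0.
apply: complexP; first by rewrite Re_clog cabs_cexp expRK.
rewrite Im_clog // Re_cexp cabs_cexp [expR _ * _]mulrC mulfK ?gt_eqF ?expR_gt0 //.
by rewrite cosK // in_itv /= !ltW.
Qed.

(** Im (cexp w) > 0 and - pi < Im w < 2 pi leave only 0 < Im w < pi for the
    sign of sin (Im w). *)
Lemma clog_cexp_wide w : - pi < Im w < pi *+ 2 -> 0 < Im (cexp w) ->
  clog (cexp w) = w.
Proof.
rewrite Im_cexp pmulr_rgt0 ?expR_gt0 // => /andP[w1 w2] sw; apply: clog_cexp.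
have [w0|w0] /= := ltP 0 (Im w); last first.
  move: sw; rewrite ltNge -[Im w]opprK sinN oppr_le0 sin_ge0_pi //.
  by rewrite oppr_ge0 w0 lerNl ltW.
have [//|wpi] := ltP (Im w) pi.
move: sw; rewrite ltNge -[Im w](subrK pi) sinDpi oppr_le0 sin_ge0_pi //.
by rewrite subr_ge0 wpi lerBlDr -mulr2n ltW.
Qed.

Lemma clog_continuous z : 0 < Im z -> forall e, 0 < e ->
  exists2 d, 0 < d & forall h, cabs h < d -> cabs (clog (z + h) - clog z) < e.
Proof.
move=> z0 e e0; have r0 := upper_cabs_gt0 z0.
have e2 : 0 < e / 2 by rewrite divr_gt0.
have [d1 d10 H1] := continuous_eps (continuous_ln r0) e2.
have [d2 d20 H2] := continuous_eps (continuous_acos (upper_cos_itv z0)) e2.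
exists (Num.min (Num.min d1 (d2 * cabs z / 4)) (Num.min (Im z) (cabs z / 2))).
  by rewrite !lt_min d10 z0 !divr_gt0 ?mulr_gt0.
move=> h; rewrite !lt_min => /andP[/andP[h1 h2] /andP[h3 h4]].
have zh0 : 0 < Im (z + h).
  by rewrite cImD; have := Im_le_cabs h; rewrite ler_norml => /andP[]; lra.
have dr : `|cabs (z + h) - cabs z| <= cabs h.
  rewrite ler_norml; have := le_normcD z h; have := ler_cabs_sub z (- h).
  by rewrite normcN opprK; lra.
rewrite (le_lt_trans (cabs_le_ReIm _)) // (splitr e) ltrD // ?(cReD, cImD, cReN, cImN).
  by rewrite !Re_clog H1 // (le_lt_trans dr).
rewrite !Im_clog // H2 //.
have r'0 : cabs z / 2 <= cabs (z + h) by move: dr; rewrite ler_norml; lra.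
have r'00 : 0 < cabs (z + h) by rewrite (lt_le_trans _ r'0) // divr_gt0.
have -> : Re (z + h) / cabs (z + h) - Re z / cabs z =
   (Re h - (Re z / cabs z) * (cabs (z + h) - cabs z)) / cabs (z + h).
  by rewrite cReD; field; rewrite !gt_eqF.
rewrite normrM normfV (gtr0_norm r'00) ltr_pdivrMr //.
have zz : `|Re z / cabs z| <= 1.
  by rewrite normrM normfV (gtr0_norm r0) ler_pdivrMr // mul1r Re_le_cabs.
have := ler_normB (Re h) ((Re z / cabs z) * (cabs (z + h) - cabs z)).
have := ler_pM (normr_ge0 _) (normr_ge0 _) zz dr; rewrite -normrM mul1r.
by have := Re_le_cabs h; move: h2; rewrite ltr_pdivlMr //; nra.
Qed.

(** Let k = clog (z + h) - clog z, so that exp k = 1 + h / z. Continuity makes k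
    small, the expansion of exp then gives k = O(h), and two substitutions in
    h / z = k + k^2 / 2 + O(k^3) give k = h / z - (h / z)^2 / 2 + O(h^3). *)
Lemma jet2_clog z : 0 < Im z -> jet2 (@clog R) z.
Proof.
move=> z0; have zn := upper_neq0 z0.
have [C [d0 [C0 d00 HC]]] := @cexp_taylor R.
pose k h := clog (z + h) - clog z.
pose d1 := Num.min d0 (Num.min 1 (2 * C + 2)^-1).
have d10 : 0 < d1 by rewrite !lt_min d00 /= invr_gt0; lra.
have [d2 d20 Hk] := clog_continuous z0 d10.
pose d := Num.min d2 (Im z).
have d_gt0 : 0 < d by rewrite lt_min d20.
have expk h : cabs h < d -> cexp (k h) = 1 + z^-1 * h.
  rewrite lt_min => /andP[_ hz]; have zh0 : 0 < Im (z + h).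
    by rewrite cImD; have := Im_le_cabs h; rewrite ler_norml => /andP[]; lra.
  by rewrite cexpD cexpN !cexp_clog // mulrDl mulfV // mulrC.
have O1k : isO 1 k.
  exists (4 * cabs z^-1), d; split => //; first by rewrite mulr_ge0 ?cabs_ge0.
  move=> h hd; have := expk h hd; move: hd; rewrite lt_min => /andP[/Hk].
  rewrite -/(k h) => kd _ E; move: kd.
  rewrite !lt_min => /andP[/HC]; rewrite E => H /andP[k1 kC].
  have kE : k h = z^-1 * h - 2^-1 * k h ^+ 2 - (1 + z^-1 * h - (1 + k h + 2^-1 * k h ^+ 2)).
    by ring.
  have := ler_cabsB (z^-1 * h - 2^-1 * k h ^+ 2) (1 + z^-1 * h - (1 + k h + 2^-1 * k h ^+ 2)).
  rewrite -kE; have := ler_cabsB (z^-1 * h) (2^-1 * k h ^+ 2).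
  rewrite (Normc.normcM 2^-1) (Normc.normcM z^-1) cabsX expr1.
  have -> : cabs (2^-1 : R[i]) = 2^-1.
    by rewrite Normc.normcV -(rmorph_nat (real_complex R)) cabs_real ger0_norm.
  have k0 := cabs_ge0 (k h).
  have Ck : (2 * C + 2) * cabs (k h) <= 1.
    by rewrite -ler_pdivlMl ?mulr1 ?ltW //; lra.
  have Ck3 : C * cabs (k h) ^+ 3 <= 2^-1 * cabs (k h) ^+ 1.
    rewrite (_ : 3%N = (1 + 2)%N) // exprD expr1 expr2; nra.
  have k2 : 2^-1 * cabs (k h) ^+ 2 <= 4^-1 * cabs (k h) ^+ 1.
    rewrite expr2 expr1; nra.
  rewrite expr1 in Ck3 k2; lra.
have O3E : isO 3 (fun h => cexp (k h) - (1 + k h + 2^-1 * k h ^+ 2)).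
  exact: (isO_comp (@cexp_taylor R) O1k).
have O3 : isO 3 (fun h => 1 + z^-1 * h - (1 + k h + 2^-1 * k h ^+ 2)).
  by apply: eq_isO d_gt0 _ O3E => h hd; rewrite expk.
have O2 : isO 2 (fun h => z^-1 * h - k h).
  apply: (isO_ext (f := fun h => (1 + z^-1 * h - (1 + k h + 2^-1 * k h ^+ 2)) +
    2^-1 * (k h * k h))) => [h|]; first by ring.
  apply: isO_add; first exact: isO_weak O3.
  by apply: isO_scale; exact: (isO_mul O1k O1k).
have O1 : isO 1 (fun h => z^-1 * h + k h).
  by apply: isO_add => //; exact: isO_ext (isO_poly z^-1 (leqnn 1)).
exists z^-1, (- 2^-1 * z^-1 ^+ 2).
apply: (isO_ext (f := fun h => - (1 + z^-1 * h - (1 + k h + 2^-1 * k h ^+ 2)) +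
    2^-1 * ((z^-1 * h - k h) * (z^-1 * h + k h)))) => [h|].
  by rewrite /k; ring.
apply: isO_add; first exact: isO_opp.
by apply: isO_scale; exact: (isO_mul O2 O1).
Qed.

Lemma cabs_cpow z s : cabs (cpow z s) = expR (s * ln (cabs z)).
Proof. by rewrite /cpow cabs_cexp cReM cReC cImC mul0r subr0 Re_clog. Qed.

Lemma jet2_cpow z s : 0 < Im z -> jet2 (fun w => cpow w s) z.
Proof.
move=> z0; apply: (jet2_comp (f := @cexp R)); last exact: jet2_cexp.
by apply: jet2_mul; [exact: jet2_cst|exact: jet2_clog].
Qed.

End Logarithm.

(** * Maximum and identity principles *)

Section MaximumPrinciple.
Variable R : realType.
Implicit Types (f : R[i] -> R[i]) (z c : R[i]).

(** Compactness and continuity are expressed in the product space R * R. *)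
Definition toC (p : R * R) : R[i] := p.1 +i* p.2.

Lemma jet2_cabs_continuous f (p : R * R) : jet2 f (toC p) ->
  {for p, continuous (fun q => cabs (f (toC q)))}.
Proof.
move=> /jet2_O1[C [d [C0 d0 H]]]; apply/cvgrPdist_lt => e e0.
pose d' := Num.min (d / 2) (e / (2 * (C + 1))).
have C1 : 0 < C + 1 by rewrite ltr_pwDr.
have d'0 : 0 < d' by rewrite lt_min !divr_gt0 ?mulr_gt0.
apply: filterS (nbhsx_ballx p d' d'0) => q [/= q1 q2].
have E : toC q = toC p + (toC q - toC p) by ring.
have hq : cabs (toC q - toC p) < 2 * d'.
  rewrite (le_lt_trans (cabs_le_ReIm _)) // !(cReD, cReN, cImD, cImN) /= mulr2n mulrDl.
  by rewrite !mul1r ltrD // distrC.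
have hd : cabs (toC q - toC p) < d.
  by rewrite (lt_le_trans hq) // mulrC -ler_pdivlMr // ge_min lexx.
have := H _ hd; rewrite -E expr1 => Hq.
have he : (C + 1) * cabs (toC q - toC p) < e.
  have : d' <= e / (2 * (C + 1)) by rewrite ge_min lexx orbT.
  by rewrite ler_pdivlMr ?mulr_gt0 //; nra.
have := ler_cabs_sub (f (toC q)) (f (toC p)).
have := ler_cabs_sub (f (toC p)) (f (toC q)); rewrite cabsBC => a b.
by have := cabs_ge0 (toC q - toC p); rewrite ltr_norml; nra.
Qed.

Lemma annulus_compact c r1 r2 :
  compact [set p : R * R | r1 <= cabs (toC p - c) <= r2].
Proof.
pose m (p : R * R) := cabs (toC p - c).
have cm : continuous m.
  by move=> p; apply: (@jet2_cabs_continuous (fun z => z - c));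
     apply: jet2_add; [exact: jet2_id|exact: jet2_cst].
apply: (@subclosed_compact _ _ (`[Re c - r2, Re c + r2] `*` `[Im c - r2, Im c + r2])).
- have -> : [set p | r1 <= cabs (toC p - c) <= r2] = m @^-1` `[r1, r2].
    by apply/seteqP; split => p /=; rewrite in_itv.
  by move/continuous_closedP : cm; apply; exact: itv_closed.
- by apply: compact_setX; exact: segment_compact.
move=> p /= /andP[_ pr]; rewrite !in_itv /=.
have := Re_le_cabs (toC p - c); have := Im_le_cabs (toC p - c).
rewrite !(cReD, cReN, cImD, cImN) /= !ler_norml => /andP[a b] /andP[a' b'].
by split; lra.
Qed.

Lemma cabs_sqrD_ge (v e : R[i]) :
  cabs v ^+ 2 - 2 * (cabs v * cabs e) <= cabs (v + e) ^+ 2.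
Proof.
have := ler_cabs_sub v (- e); rewrite normcN opprK.
have := cabs_ge0 v; have := cabs_ge0 e; have := cabs_ge0 (v + e).
by have [] := leP (cabs v) (cabs e); nra.
Qed.

(** The average over h = s, -s, is, -is of the right-hand sides exceeds the
    left-hand side by |a|^2 s^2 + |b|^2 s^4 + eps s^2 + O(s^3). *)
Lemma jet2_not_max f z (eps d : R) : jet2 f z -> 0 < eps -> 0 < d ->
  exists2 h, cabs h < d &
    cabs (f z) ^+ 2 + eps * cabs z ^+ 2 <
    cabs (f (z + h)) ^+ 2 + eps * cabs (z + h) ^+ 2.
Proof.
move=> [a [b [C [d' [C0 d'0 H]]]]] eps0 d0.
apply/not_exists2P => Hle.
have {}Hle h : cabs h < d -> cabs (f (z + h)) ^+ 2 + eps * cabs (z + h) ^+ 2 <=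
    cabs (f z) ^+ 2 + eps * cabs z ^+ 2.
  by move=> hd; have [//|] := Hle h => /negP; rewrite -leNgt.
(* V bounds the main part of f (z + h) when |h| <= 1; s is so small that eps s^2
   beats the error 2 V C s^3. *)
pose V := cabs (f z) + cabs a + cabs b.
have V0 : 0 <= V by rewrite !addr_ge0 ?cabs_ge0.
have VC : 0 < 2 * (V * C) + 1 by rewrite ltr_pwDr // !mulr_ge0.
pose s0 := Num.min (Num.min d d') (Num.min 1 (eps / (2 * (V * C) + 1))).
have s00 : 0 < s0 by rewrite !lt_min d0 d'0 ltr01 divr_gt0.
pose s := s0 / 2.
have s_gt0 : 0 < s by rewrite divr_gt0.
have : s < s0 by rewrite /s; lra.
rewrite !lt_min => /andP[/andP[sd sd'] /andP[s1 se]].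
pose v (w : R[i]) := f z + a * (s%:C * w) + b * (s%:C * w) ^+ 2.
have main w : cabs w = 1 ->
   cabs (v w) ^+ 2 - 2 * (V * C) * s ^+ 3 + eps * cabs (z + s%:C * w) ^+ 2
     <= cabs (f z) ^+ 2 + eps * cabs z ^+ 2.
  move=> w1; pose h := s%:C * w.
  have hs : cabs h = s by rewrite Normc.normcM w1 mulr1 cabs_real gtr0_norm.
  apply: (le_trans _ (Hle h _)); last by rewrite hs.
  rewrite lerD2r; have := H h; rewrite hs -/(v w) => /(_ sd') He.
  have -> : f (z + h) = v w + (f (z + h) - v w) by ring.
  apply: (le_trans _ (cabs_sqrD_ge _ _)); rewrite lerD2l lerN2 -!mulrA ler_pM2l //.
  rewrite ler_pM ?cabs_ge0 //.
  rewrite /V (le_trans (le_normcD _ _)) // lerD //.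
    rewrite (le_trans (le_normcD _ _)) // lerD // Normc.normcM hs.
    by rewrite ler_piMr ?cabs_ge0 // ltW.
  rewrite Normc.normcM cabsX hs ler_piMr ?cabs_ge0 //.
  by apply: exprn_ile1; exact: ltW.
have m1 := main 1 (Normc.normc1 _).
have m2 := main (-1); rewrite normcN Normc.normc1 in m2; have {}m2 := m2 erefl.
have m3 := main 'i%C (cabs_i _).
have m4 := main (- 'i%C); rewrite normcN cabs_i in m4; have {}m4 := m4 erefl.
have : cabs (v 1) ^+ 2 + cabs (v (-1)) ^+ 2 + cabs (v 'i%C) ^+ 2 + cabs (v (- 'i%C)) ^+ 2 =
   4 * (cabs (f z) ^+ 2 + cabs a ^+ 2 * s ^+ 2 + cabs b ^+ 2 * s ^+ 4).
  rewrite /v; move: (f z) => fz; rewrite !cabs_sqr !expr2 !ReImE.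
  by ring.
have : cabs (z + s%:C * 1) ^+ 2 + cabs (z + s%:C * (-1)) ^+ 2 +
       cabs (z + s%:C * 'i%C) ^+ 2 + cabs (z + s%:C * - 'i%C) ^+ 2 =
   4 * (cabs z ^+ 2 + s ^+ 2).
  by rewrite !cabs_sqr !ReImE; ring.
move: m1 m2 m3 m4.
move: (cabs (v 1) ^+ 2) (cabs (v (-1)) ^+ 2) (cabs (v 'i%C) ^+ 2) (cabs (v (- 'i%C)) ^+ 2).
move: (cabs (z + s%:C * 1) ^+ 2) (cabs (z + s%:C * (-1)) ^+ 2).
move: (cabs (z + s%:C * 'i%C) ^+ 2) (cabs (z + s%:C * - 'i%C) ^+ 2).
move=> z1 z2 z3 z4 v1 v2 v3 v4 m1 m2 m3 m4 sz sv.
have A0 : 0 <= cabs a ^+ 2 * s ^+ 2 by rewrite mulr_ge0 ?exprn_ge0 ?cabs_ge0 // ltW.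
have B0 : 0 <= cabs b ^+ 2 * s ^+ 4 by rewrite mulr_ge0 ?exprn_ge0 ?cabs_ge0 // ltW.
have se' : (2 * (V * C) + 1) * s < eps by rewrite mulrC -ltr_pdivlMr.
have S2 : 0 < s ^+ 2 by rewrite exprn_gt0.
have sV : 2 * (V * C) * s ^+ 3 < eps * s ^+ 2.
  by rewrite (exprS s 2) [ltLHS]mulrA ltr_pM2r //; lra.
have eSz : eps * z1 + eps * z2 + eps * z3 + eps * z4 = 4 * (eps * cabs z ^+ 2 + eps * s ^+ 2).
  have -> : eps * z1 + eps * z2 + eps * z3 + eps * z4 = eps * (z3 + z4 + z1 + z2) by ring.
  by rewrite sz; ring.
lra.
Qed.

(** The radius r1 may be negative, in which case the annulus is a disc. The
    perturbation eps |z|^2 of |f|^2 is small enough for a value above B at one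
    point to keep the maximum away from the boundary. *)
Lemma max_principle f c (r1 r2 B : R) : 0 <= B ->
  (forall z, r1 <= cabs (z - c) <= r2 -> jet2 f z) ->
  (forall z, cabs (z - c) = r1 \/ cabs (z - c) = r2 -> cabs (f z) <= B) ->
  forall z, r1 <= cabs (z - c) <= r2 -> cabs (f z) <= B.
Proof.
move=> B0 Jf bd z0 z0A; rewrite leNgt; apply/negP => fz0.
pose A := [set p : R * R | r1 <= cabs (toC p - c) <= r2].
have toCK z : toC (Re z, Im z) = z by case: z.
pose L := cabs c + r2.
have LA p : A p -> cabs (toC p) ^+ 2 <= L ^+ 2.
  move=> /andP[_ pr]; have pL : cabs (toC p) <= L.
    by have := le_normcD (toC p - c) c; rewrite subrK /L; lra.
  by rewrite lerXn2r ?nnegrE ?cabs_ge0 // (le_trans (cabs_ge0 _) pL).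
have L1 : 0 < L ^+ 2 + 1 by rewrite ltr_pwDr // sqr_ge0.
have D0 : 0 < cabs (f z0) ^+ 2 - B ^+ 2.
  by rewrite subr_gt0 ltrXn2r ?nnegrE // cabs_ge0.
pose eps := (cabs (f z0) ^+ 2 - B ^+ 2) / (2 * (L ^+ 2 + 1)).
have eps0 : 0 < eps by rewrite divr_gt0 // mulr_gt0.
have epsE : eps * (2 * (L ^+ 2 + 1)) = cabs (f z0) ^+ 2 - B ^+ 2.
  by rewrite /eps divfK // mulf_neq0 // gt_eqF.
pose u (p : R * R) := cabs (f (toC p)) ^+ 2 + eps * cabs (toC p) ^+ 2.
have cu : {within A, continuous u}.
  apply: continuous_in_subspaceT => p /set_mem pA.
  have c1 := jet2_cabs_continuous (Jf _ pA).
  have c2 := jet2_cabs_continuous (jet2_id (toC p)).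
  apply: cvgD; first exact: (cvgM c1 c1).
  apply: cvgM; first exact: cvg_cst.
  exact: (cvgM c2 c2).
have A0 : A !=set0 by exists (Re z0, Im z0); rewrite /A /= toCK.
have [p /set_mem pA pmax] := compact_EVT_max A0 (@annulus_compact c r1 r2) cu.
have fpB : B < cabs (f (toC p)).
  rewrite ltNge; apply/negP => fpB.
  have := pmax (Re z0, Im z0); rewrite /u toCK => /(_ _)/wrap[].
    by apply/mem_set; rewrite /A /= toCK.
  have := LA _ pA; have := cabs_ge0 (f (toC p)); have := sqr_ge0 (cabs z0).
  have : cabs (f (toC p)) ^+ 2 <= B ^+ 2 by rewrite lerXn2r ?nnegrE ?cabs_ge0.
  nra.
have r1p : r1 < cabs (toC p - c).
  rewrite lt_neqAle; move: (pA) => /andP[-> _]; rewrite andbT.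
  by apply/eqP => E; have := bd (toC p) (or_introl (esym E)); rewrite leNgt fpB.
have r2p : cabs (toC p - c) < r2.
  rewrite lt_neqAle; move: (pA) => /andP[_ ->]; rewrite andbT.
  by apply/eqP => E; have := bd (toC p) (or_intror E); rewrite leNgt fpB.
pose d := Num.min (cabs (toC p - c) - r1) (r2 - cabs (toC p - c)).
have d0 : 0 < d by rewrite lt_min !subr_gt0 r1p.
have [h hd] := jet2_not_max (Jf _ pA) eps0 d0.
apply/negP; rewrite -leNgt.
have := pmax (Re (toC p + h), Im (toC p + h)); rewrite /u toCK; apply.
apply/mem_set; rewrite /A /= toCK; move: hd; rewrite lt_min => /andP[h1 h2].
rewrite (_ : toC p + h - c = (toC p - c) + h); last by ring.
have := le_normcD (toC p - c) h; have := ler_cabs_sub (toC p - c) (- h).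
by rewrite normcN opprK => a b; apply/andP; split; lra.
Qed.

(** On the annulus e / 2 <= |z - c| <= t, the function f / (z - c)^n vanishes on
    the inner circle and is at most B / t^n on the outer one, so that
    |f z0| <= B (|z0 - c| / t)^n for all n. *)
Lemma identity_disc f c (e r : R) : 0 < e ->
  (forall z, cabs (z - c) < r -> jet2 f z) ->
  (forall z, cabs (z - c) < e -> f z = 0) ->
  forall z, cabs (z - c) < r -> f z = 0.
Proof.
move=> e0 Jf f0 z0 z0r; have [/f0 //|ez0] := ltP (cabs (z0 - c)) e.
have zc0 : 0 < cabs (z0 - c) by rewrite (lt_le_trans e0).
pose t := (cabs (z0 - c) + r) / 2; have t0 : cabs (z0 - c) < t by rewrite /t; lra.
have tr : t < r by rewrite /t; lra.
have t_gt0 : 0 < t by rewrite (lt_trans zc0).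
have [B B0 HB] : exists2 B, 0 <= B & forall z, cabs (z - c) = t -> cabs (f z) <= B.
  pose A := [set p : R * R | t <= cabs (toC p - c) <= t].
  have A0 : A !=set0.
    exists (Re (c + t%:C), Im (c + t%:C)); rewrite /A /=.
    have -> : toC (Re (c + t%:C), Im (c + t%:C)) - c = t%:C.
      by rewrite /toC; case: (c) => a b /=; apply: complexP => /=; ring.
    by rewrite cabs_real gtr0_norm // lexx.
  pose u (p : R * R) := cabs (f (toC p)).
  have cu : {within A, continuous u}.
    apply: continuous_in_subspaceT => p /set_mem /andP[_ pA].
    by apply: jet2_cabs_continuous; apply: Jf; rewrite (le_lt_trans pA).
  have [p _ pmax] := compact_EVT_max A0 (@annulus_compact c t t) cu.
  exists (u p) => [|z zt]; first exact: cabs_ge0.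
  have E : toC (Re z, Im z) = z by case: (z).
  have := pmax (Re z, Im z); rewrite /u E; apply.
  by apply/mem_set; rewrite /A /= E zt lexx.
have bound n : cabs (f z0) <= B * (cabs (z0 - c) / t) ^+ n.
  pose g z := f z * ((z - c)^-1) ^+ n.
  have gB : cabs (g z0) <= B * t^-1 ^+ n.
    apply: (@max_principle g c (e / 2) t) => [|z /andP[ez zt]|z [ez|zt]|].
    - by rewrite mulr_ge0 // exprn_ge0 // invr_ge0 ltW.
    - have zc : z - c != 0 by rewrite -cabs_gt0 (lt_le_trans _ ez) // divr_gt0.
      apply: jet2_mul; first by apply: Jf; rewrite (le_lt_trans zt).
      apply: jet2_exp; apply: (@jet2_comp _ (fun w => w - c)); last exact: jet2_inv.
      by apply: jet2_add; [exact: jet2_id|exact: jet2_cst].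
    - rewrite /g f0; last by rewrite ez; lra.
      by rewrite mul0r cabs0 mulr_ge0 // exprn_ge0 // invr_ge0 ltW.
    - rewrite /g Normc.normcM cabsX Normc.normcV zt ler_wpM2r ?HB //.
      by rewrite exprn_ge0 // invr_ge0 ltW.
    - by rewrite (ltW t0) andbT; lra.
  have -> : f z0 = g z0 * (z0 - c) ^+ n.
    by rewrite /g -mulrA -exprMn mulVf -?cabs_gt0 // expr1n mulr1.
  rewrite Normc.normcM cabsX expr_div_n (mulrC (cabs (z0 - c) ^+ n)) mulrA -exprVn.
  by rewrite ler_wpM2r // exprn_ge0 // cabs_ge0.
pose q := cabs (z0 - c) / t.
have q1 : `|q| < 1.
  by rewrite /q ger0_norm ?ltr_pdivrMr ?mul1r // divr_ge0 ?cabs_ge0 // ltW.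
have [//|fz0] := eqVneq (f z0) 0; exfalso.
have B1 : 0 < B + 1 by rewrite ltr_pwDr.
have /cvgrPdist_lt /(_ (cabs (f z0) / (B + 1))) := cvg_expr q1.
rewrite divr_gt0 ?cabs_gt0 // => /(_ isT)[N _ /(_ N (leqnn N))] /=.
rewrite sub0r normrN ltr_pdivlMr // => qN.
have := bound N; rewrite -/q; apply/negP; rewrite -ltNge (le_lt_trans _ qN) //.
rewrite mulrC (le_trans (ler_wpM2r B0 (ler_norm _))) // ler_wpM2l //.
by rewrite lerDl.
Qed.

(** A point z of the half-plane belongs to the disc |z - iM| < M as soon as
    M > |z|^2 / (2 Im z). *)
Lemma identity_upper f (M0 : R) :
  (forall z, 0 < Im z -> jet2 f z) ->
  (forall M, M0 <= M -> exists2 e, 0 < e & forall z, cabs (z - 0 +i* M) < e -> f z = 0) ->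
  forall z, 0 < Im z -> f z = 0.
Proof.
move=> Jf f0 z z0.
pose M := Num.max (Num.max M0 1) (cabs z ^+ 2 / Im z).
have [MM0 M1] : M0 <= M /\ 1 <= M by rewrite /M !le_max !lexx !orbT.
have Mz : cabs z ^+ 2 / Im z <= M by rewrite /M le_max lexx orbT.
have [e e0 fe] := f0 M MM0.
apply: (identity_disc (c := 0 +i* M) (r := M) e0 _ fe) => [w wM|].
  apply: Jf; have := Im_le_cabs (w - 0 +i* M); rewrite !ReImE /= ler_norml => /andP[].
  by lra.
rewrite -(@ltr_pXn2r _ 2) ?nnegrE ?cabs_ge0 ?(le_trans ler01) //.
rewrite cabs_sqr !ReImE /= subr0; move: Mz; rewrite ler_pdivrMr // cabs_sqr.
by nra.
Qed.

End MaximumPrinciple.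

(** * Regularity of the Cauchy transform *)

Section CauchyTransform.
Variables (R : realType) (mu : probability (measurableTypeR R) R).
Local Notation T := (measurableTypeR R).
Implicit Types (f g : T -> R[i]) (z : R[i]).

Definition cint f : R[i] :=
  (\int[mu]_(t in setT) Re (f t)) +i* (\int[mu]_(t in setT) Im (f t)).

Definition bounded_measurable f := [/\ measurable_fun setT (Re \o f),
  measurable_fun setT (Im \o f) & exists B, forall t, cabs (f t) <= B].

Lemma bounded_integrable (h : T -> R) (B : R) : measurable_fun setT h ->
  (forall t, `|h t| <= B) -> mu.-integrable setT (EFin \o h).
Proof.
move=> mh hB; apply: measurable_bounded_integrable => //.
  exact: (le_lt_trans (probability_le1 mu measurableT) (ltry 1)).
exists B; split; first exact: num_real.
by move=> M BM t _; exact: (le_trans (hB t) (ltW BM)).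
Qed.

Lemma bm_integrable f : bounded_measurable f ->
  mu.-integrable setT (EFin \o (Re \o f)) /\ mu.-integrable setT (EFin \o (Im \o f)).
Proof.
move=> [mr mi [B fB]]; split.
  by apply: (bounded_integrable (B := B)) => // t; rewrite (le_trans (Re_le_cabs _)).
by apply: (bounded_integrable (B := B)) => // t; rewrite (le_trans (Im_le_cabs _)).
Qed.

Lemma bm_cst c : bounded_measurable (fun=> c).
Proof. by split; [exact: measurable_cst|exact: measurable_cst|exists (cabs c)]. Qed.

Lemma bm_add f g : bounded_measurable f -> bounded_measurable g ->
  bounded_measurable (fun t => f t + g t).
Proof.
move=> [mr mi [B fB]] [mr' mi' [B' gB]]; split.
- rewrite (_ : _ \o _ = (Re \o f) \+ (Re \o g)); first exact: measurable_funD.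
  by apply/funext => t /=; rewrite cReD.
- rewrite (_ : _ \o _ = (Im \o f) \+ (Im \o g)); first exact: measurable_funD.
  by apply/funext => t /=; rewrite cImD.
by exists (B + B') => t; rewrite (le_trans (le_normcD _ _)) // lerD.
Qed.

Lemma bm_mul f g : bounded_measurable f -> bounded_measurable g ->
  bounded_measurable (fun t => f t * g t).
Proof.
move=> [mr mi [B fB]] [mr' mi' [B' gB]]; split.
- rewrite (_ : _ \o _ = ((Re \o f) \* (Re \o g)) \- ((Im \o f) \* (Im \o g))).
    by apply: measurable_funB; exact: measurable_funM.
  by apply/funext => t /=; rewrite cReM.
- rewrite (_ : _ \o _ = ((Re \o f) \* (Im \o g)) \+ ((Im \o f) \* (Re \o g))).
    by apply: measurable_funD; exact: measurable_funM.
  by apply/funext => t /=; rewrite cImM.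
by exists (B * B') => t; rewrite Normc.normcM ler_pM ?cabs_ge0.
Qed.

Lemma cint_add f g : bounded_measurable f -> bounded_measurable g ->
  cint (fun t => f t + g t) = cint f + cint g.
Proof.
move=> /bm_integrable[fr fi] /bm_integrable[gr gi].
apply: complexP; rewrite ?cReD ?cImD /cint /= -RintegralD //.
  by apply: eq_Rintegral => t _; rewrite /= cReD.
by apply: eq_Rintegral => t _; rewrite /= cImD.
Qed.

Lemma cint_scale c f : bounded_measurable f ->
  cint (fun t => c * f t) = c * cint f.
Proof.
move=> /bm_integrable[fr fi].
have Zr (a : R) : mu.-integrable setT (EFin \o (fun t => a * Re (f t))).
  exact: (integrableZl measurableT a fr).
have Zi (a : R) : mu.-integrable setT (EFin \o (fun t => a * Im (f t))).
  exact: (integrableZl measurableT a fi).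
apply: complexP; rewrite ?cReM ?cImM /cint /=.
  rewrite -!RintegralZl // -RintegralB //.
  by apply: eq_Rintegral => t _; rewrite /= cReM.
rewrite -!RintegralZl // -RintegralD //.
by apply: eq_Rintegral => t _; rewrite /= cImM.
Qed.

Lemma Rintegral_norm_le (h : T -> R) (B : R) : measurable_fun setT h ->
  (forall t, `|h t| <= B) -> `|\int[mu]_(t in setT) h t| <= B.
Proof.
move=> mh hB; have ih := bounded_integrable mh hB.
rewrite (le_trans (le_normr_Rintegral _ ih)) //.
have -> : B = \int[mu]_(t in setT) B.
  by rewrite Rintegral_cst // (congr1 fine (probability_setT mu)) mulr1.
apply: le_Rintegral => //.
  apply: (bounded_integrable (B := B)) => [|t]; last by rewrite normr_id.
  exact: measurableT_comp.
by apply: (bounded_integrable (B := `|B|)).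
Qed.

(** The factor 2 comes from bounding the real and imaginary parts separately. *)
Lemma cabs_cint_le f (B : R) : bounded_measurable f -> (forall t, cabs (f t) <= B) ->
  cabs (cint f) <= 2 * B.
Proof.
move=> [mr mi _] fB; rewrite (le_trans (cabs_le_ReIm _)) // mulr2n mulrDl mul1r.
by rewrite lerD // Rintegral_norm_le // => t;
  rewrite (le_trans _ (fB t)) ?Re_le_cabs ?Im_le_cabs.
Qed.

Lemma Re_inv z : Re z^-1 = Re z / (Re z ^+ 2 + Im z ^+ 2).
Proof. by case: z. Qed.

Lemma Im_inv z : Im z^-1 = - (Im z / (Re z ^+ 2 + Im z ^+ 2)).
Proof. by case: z. Qed.

Lemma sub_real_neq0 z (t : R) : Im z != 0 -> z - t%:C != 0.
Proof. by move=> z0; apply: Im_neq0; rewrite !ReImE subr0. Qed.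

Lemma resolvent_le z (t : R) : Im z != 0 -> cabs (z - t%:C)^-1 <= `|Im z|^-1.
Proof.
move=> z0; rewrite Normc.normcV lef_pV2 ?posrE ?normr_gt0 ?cabs_gt0 ?sub_real_neq0 //.
by have := Im_le_cabs (z - t%:C); rewrite !ReImE subr0.
Qed.

Lemma bm_resolvent z : Im z != 0 -> bounded_measurable (fun t => (z - t%:C)^-1).
Proof.
move=> z0; have D0 (t : R) : (Re z - t) ^+ 2 + Im z ^+ 2 != 0.
  by rewrite gt_eqF // ltr_wpDl ?sqr_ge0 // lt0r sqrf_eq0 z0 sqr_ge0.
have cD : continuous (fun t : R => ((Re z - t) ^+ 2 + Im z ^+ 2)^-1).
  move=> t; apply: cvgV => //; apply: cvgD; last exact: cvg_cst.
  by rewrite expr2; apply: cvgM; apply: cvgB => //; exact: cvg_cst.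
split; last by exists `|Im z|^-1 => t; exact: resolvent_le.
- rewrite (_ : _ \o _ = fun t : R => (Re z - t) * ((Re z - t) ^+ 2 + Im z ^+ 2)^-1).
    apply: continuous_measurable_fun => t; apply: cvgM; last exact: cD.
    by apply: cvgB => //; exact: cvg_cst.
  by apply/funext => t /=; rewrite Re_inv !ReImE subr0.
- rewrite (_ : _ \o _ = fun t : R => - Im z * ((Re z - t) ^+ 2 + Im z ^+ 2)^-1).
    apply: continuous_measurable_fun => t; apply: cvgM; last exact: cD.
    exact: cvg_cst.
  by apply/funext => t /=; rewrite Im_inv !ReImE subr0 mulNr.
Qed.

(** Integration of the geometric identity
    s = r - h r^2 + h^2 r^3 - h^3 r^3 s for r = 1 / (z - t), s = 1 / (z + h - t),
    with |r| <= 1 / |Im z| and, for |h| < |Im z| / 2, |s| <= 2 / |Im z|. *)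
Lemma jet2_cauchy z : Im z != 0 -> jet2 (cauchy_transform mu) z.
Proof.
move=> z0; pose r t := (z - t%:C)^-1 : R[i].
have y0 : 0 < `|Im z| by rewrite normr_gt0.
have br : bounded_measurable r := bm_resolvent z0.
have br2 := bm_mul br br; have br3 := bm_mul br2 br.
exists (- cint (fun t => r t * r t)), (cint (fun t => r t * r t * r t)).
exists (2 * (2 * (`|Im z|^-1) ^+ 4)), (`|Im z| / 2); split => [||h hz].
- by rewrite !mulr_ge0 // exprn_ge0 // invr_ge0.
- by rewrite divr_gt0.
have zh : `|Im z| / 2 <= `|Im (z + h)|.
  have := Im_le_cabs h; have := ler_normB (Im (z + h)) (Im h).
  by rewrite cImD addrK; lra.
have zh0 : Im (z + h) != 0 by rewrite -normr_gt0 (lt_le_trans _ zh) // divr_gt0.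
pose s t := (z + h - t%:C)^-1 : R[i].
have bs : bounded_measurable s := bm_resolvent zh0.
have E t : s t = r t + (- h * (r t * r t) + (h ^+ 2 * (r t * r t * r t) +
    (- h ^+ 3) * (r t * r t * r t * s t))).
  rewrite /s /r; have := sub_real_neq0 t z0; have := sub_real_neq0 t zh0.
  by move=> a b; field; rewrite b -addrA (addrC h) addrA addrAC a.
have bm4 := bm_mul br3 bs.
have -> : cauchy_transform mu (z + h) = cint s by [].
have -> : cauchy_transform mu z = cint r by [].
have -> : cint s = cint r + (- h * cint (fun t => r t * r t) +
   (h ^+ 2 * cint (fun t => r t * r t * r t) +
    (- h ^+ 3) * cint (fun t => r t * r t * r t * s t))).
  have bc c f : bounded_measurable f -> bounded_measurable (fun t => c * f t).
    exact: bm_mul (bm_cst c).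
  rewrite -!cint_scale // -!cint_add; do ?[exact: br|exact: bc|apply: bm_add].
  by congr cint; apply/funext => t; exact: E.
set I4 := cint (fun t => _ * s t).
have -> : forall a b c : R[i], a + (- h * b + (h ^+ 2 * c + - h ^+ 3 * I4)) -
   (a + - b * h + c * h ^+ 2) = - (h ^+ 3 * I4) by move=> a b c; ring.
rewrite normcN Normc.normcM cabsX mulrC ler_wpM2r ?exprn_ge0 ?cabs_ge0 //.
apply: cabs_cint_le => // t; rewrite !Normc.normcM.
have rt := resolvent_le t z0; have st : cabs (s t) <= 2 * `|Im z|^-1.
  rewrite (le_trans (resolvent_le t zh0)) // -[2]invrK -invfM mulrC.
  by rewrite lef_pV2 ?posrE ?divr_gt0 ?normr_gt0.
have y0' : 0 <= `|Im z|^-1 by rewrite invr_ge0.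
apply: (le_trans (y := (`|Im z|^-1 * `|Im z|^-1 * `|Im z|^-1) * (2 * `|Im z|^-1))).
  by do ![rewrite ler_pM ?mulr_ge0 ?cabs_ge0 //].
by rewrite le_eqVlt; apply/orP; left; apply/eqP; ring.
Qed.

Lemma cauchy_conj z : Im z != 0 -> cauchy_transform mu (conjc z) = conjc (cauchy_transform mu z).
Proof.
move=> z0; have E t : (conjc z - t%:C)^-1 = conjc (z - t%:C)^-1.
  by rewrite conjc_inv; congr (_^-1); case: (z) => a b; apply: complexP => /=; ring.
apply: complexP; rewrite /cauchy_transform /=.
  by apply: eq_Rintegral => t _; rewrite E cRe_conj.
have [_ ii] := bm_integrable (bm_resolvent z0).
rewrite -mulN1r -RintegralZl //.
by apply: eq_Rintegral => t _; rewrite E cIm_conj mulN1r.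
Qed.

End CauchyTransform.

(** * Stieltjes inversion *)

Section Boundary.
Variables (R : realType) (nu : probability (measurableTypeR R) R).
Local Notation T := (measurableTypeR R).
Local Notation leb := (@lebesgue_measure R).
Implicit Types (z : R[i]).

Definition poisson z (t : R) : R := Im z / ((Re z - t) ^+ 2 + Im z ^+ 2).

Lemma poisson_den_gt0 z (t : R) : 0 < Im z -> 0 < (Re z - t) ^+ 2 + Im z ^+ 2.
Proof. by move=> z0; rewrite ltr_wpDl ?sqr_ge0 ?exprn_gt0. Qed.

Lemma poisson_gt0 z (t : R) : 0 < Im z -> 0 < poisson z t.
Proof. by move=> z0; rewrite divr_gt0 ?poisson_den_gt0. Qed.

Lemma poissonE z (t : R) : Im (z - t%:C)^-1 = - poisson z t.
Proof. by rewrite Im_inv !ReImE subr0. Qed.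

Lemma continuous_poisson z : 0 < Im z -> continuous (poisson z).
Proof.
move=> z0 t; apply: cvgM; first exact: cvg_cst.
apply: cvgV; first by rewrite gt_eqF // poisson_den_gt0.
apply: cvgD; last exact: cvg_cst.
by rewrite expr2; apply: cvgM; apply: cvgB => //; exact: cvg_cst.
Qed.

Lemma poisson_integrable z : 0 < Im z -> nu.-integrable setT (EFin \o poisson z).
Proof.
move=> z0; have z0' : Im z != 0 by rewrite gt_eqF.
apply: (@bounded_integrable _ nu _ (`|Im z|^-1)) => [|t].
  by apply: continuous_measurable_fun; exact: continuous_poisson.
rewrite -normrN -poissonE (le_trans (Im_le_cabs _)) //; exact: resolvent_le.
Qed.

Lemma Im_cauchy z : 0 < Im z ->
  Im (cauchy_transform nu z) = - \int[nu]_(t in setT) poisson z t.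
Proof.
move=> z0; rewrite /cauchy_transform /= -mulN1r -RintegralZl //; last exact: poisson_integrable.
by apply: eq_Rintegral => t _; rewrite poissonE mulN1r.
Qed.

(** If the integral of the positive function [poisson z] were 0, the whole line
    would be negligible. *)
Lemma Im_cauchy_lt0 z : 0 < Im z -> Im (cauchy_transform nu z) < 0.
Proof.
move=> z0; rewrite Im_cauchy // oppr_lt0 lt_neqAle; apply/andP; split; last first.
  by apply: Rintegral_ge0 => t _; rewrite ltW // poisson_gt0.
apply/eqP => I0; have Pi := poisson_integrable z0.
have : (\int[nu]_(t in setT) `|(poisson z t)%:E| = 0)%E.
  under eq_integral do rewrite gee0_abs ?lee_fin ?ltW ?poisson_gt0 //.
  by rewrite -[LHS]fineK ?integrable_fin_num // -[fine _]I0.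
move/ae_eq_integral_abs => /(_ measurableT (measurable_int _ Pi)) [A [mA A0 TA]].
have AT : A = setT.
  apply/seteqP; split => // t _; apply: TA => /= /(_ I) /eqP.
  by rewrite eqe gt_eqF // poisson_gt0.
by have := probability_setT nu; rewrite -AT A0 => /esym/eqP; rewrite onee_eq0.
Qed.

Variable psi : R -> R.
Hypothesis Hpsi : is_continuous_density nu psi.

Lemma density_dominates : nu `<< leb.
Proof.
have [cpsi psi0 nuE] := Hpsi.
apply/null_content_dominatesP => A mA A0; rewrite nuE //.
apply: null_set_integral => //; apply: measurable_funTS.
by apply/measurable_EFinP; exact: continuous_measurable_fun.
Qed.

(** A density is almost everywhere equal to the Radon-Nikodym derivative. *)
Lemma integral_density (U : set T) (f : T -> \bar R) : measurable U ->
  nu.-integrable U f ->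
  (\int[nu]_(x in U) f x = \int[leb]_(x in U) (f x * (psi x)%:E))%E.
Proof.
have [cpsi psi0 nuE] := Hpsi.
have mpsi : measurable_fun setT (EFin \o psi : T -> \bar R).
  by apply/measurable_EFinP; exact: continuous_measurable_fun.
move=> mU intf; have mf := measurable_int _ intf.
rewrite -(Radon_Nikodym_change_of_variables density_dominates) //.
apply: ae_eq_integral => //.
- apply: emeasurable_funM => //; apply: (measurable_int leb).
  apply: (integrableS _ _ (@subsetT _ _)) => //=.
  by apply: Radon_Nikodym_integrable; exact: density_dominates.
- by apply: emeasurable_funM => //=; exact: measurable_funTS.
- apply: ae_eqe_mul2l => /=.
  rewrite Radon_NikodymE //=; first exact: density_dominates.
  move=> numu; case: cid => /= h [h1 h2 h3].
  apply: integral_ae_eq => //=.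
  + exact: integrableS h2.
  + exact: measurable_funTS.
  + by move=> E E01 mE; rewrite -h3 //= nuE.
Qed.

Lemma poisson_mass z (a b : R) : 0 < Im z -> a < b ->
  \int[leb]_(t in `[a, b]) poisson z t =
    atan ((b - Re z) / Im z) - atan ((a - Re z) / Im z).
Proof.
move=> z0 ab; pose F t := atan ((t - Re z) / Im z).
have dF (t : R) : is_derive t 1 F (poisson z t).
  rewrite /F; apply: is_derive_eq.
  rewrite /GRing.scale /= /poisson; have := poisson_den_gt0 t z0 => D0.
  field; rewrite !gt_eqF //.
have cF : continuous F.
  by move=> t; apply/differentiable_continuous/derivable1_diffP; case: (dF t).
rewrite /Rintegral (@continuous_FTC2 _ (poisson z) F) //.
- by apply: continuous_subspaceT; exact: continuous_poisson.
- split; first by move=> t _; case: (dF t).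
    exact/cvg_at_right_filter/cF.
  exact/cvg_at_left_filter/cF.
- by move=> t _; rewrite derive1E; case: (dF t).
Qed.

Lemma near_part_bounds z (a b lo hi : R) : 0 < Im z -> a < b ->
  (forall t, a <= t <= b -> lo <= psi t <= hi) ->
  lo * (atan ((b - Re z) / Im z) - atan ((a - Re z) / Im z))
    <= \int[nu]_(t in `[a, b]) poisson z t
    <= hi * (atan ((b - Re z) / Im z) - atan ((a - Re z) / Im z)).
Proof.
move=> z0 ab psi_itv; have [cpsi psi0 nuE] := Hpsi.
have -> : \int[nu]_(t in `[a, b]) poisson z t =
    \int[leb]_(t in `[a, b]) (poisson z t * psi t).
  rewrite /Rintegral integral_density //.
  exact: integrableS (poisson_integrable z0).
have cint (g : R -> R) : continuous g -> leb.-integrable `[a, b] (EFin \o g).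
  move=> cg; apply: continuous_compact_integrable; first exact: segment_compact.
  exact: continuous_subspaceT.
have cP := continuous_poisson z0.
have cPc c : continuous (fun t => c * poisson z t).
  by move=> t; apply: cvgM; [exact: cvg_cst|exact: cP].
have cPp : continuous (fun t => poisson z t * psi t).
  by move=> t; apply: cvgM; [exact: cP|exact: cpsi].
rewrite -poisson_mass // -!RintegralZl //; try exact: cint.
apply/andP; split; apply: le_Rintegral => //; try exact: cint.
  move=> t /=; rewrite in_itv /= => /psi_itv/andP[h1 _].
  by rewrite mulrC ler_wpM2l // ltW // poisson_gt0.
move=> t /=; rewrite in_itv /= => /psi_itv/andP[_ h1].
by rewrite [hi * _]mulrC ler_wpM2l // ltW // poisson_gt0.
Qed.

Lemma far_part_bounds z (a b d : R) : 0 < Im z -> 0 < d ->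
  a + d <= Re z <= b - d ->
  0 <= \int[nu]_(t in ~` `[a, b]) poisson z t <= Im z / d ^+ 2.
Proof.
move=> z0 d0 /andP[za zb]; apply/andP; split.
  by apply: Rintegral_ge0 => t _; rewrite ltW // poisson_gt0.
have mC : measurable (~` `[a, b]%classic : set T) by exact: measurableC.
have B0 : 0 <= Im z / d ^+ 2 by rewrite divr_ge0 ?exprn_ge0 // ltW.
apply: (le_trans (y := \int[nu]_(t in ~` `[a, b]) (Im z / d ^+ 2))).
  apply: le_Rintegral => //.
  - exact: integrableS (poisson_integrable z0).
  - apply: (@integrableS _ _ _ nu setT) => //.
    exact: (@bounded_integrable _ nu _ (`|Im z / d ^+ 2|)).
  move=> t /=; rewrite in_itv /= => /negP tab.
  rewrite ler_pM2l // lef_pV2 ?posrE ?exprn_gt0 ?poisson_den_gt0 //.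
  rewrite ler_wpDr ?sqr_ge0 //.
  by move: tab; rewrite negb_and -!ltNge => /orP[h|h]; nra.
rewrite Rintegral_cst // ler_piMr //.
exact: (fine_le (fin_num_measure nu _ mC) (isT : 1%E \is a fin_num) (probability_le1 nu mC)).
Qed.

(** The limit is taken along all approaches to x from the upper half-plane. Near
    x, psi is almost constant and the Poisson kernel has mass almost pi; away from
    x, the kernel is at most Im z / D^2 and nu has total mass 1. *)
Lemma stieltjes_inversion x e : 0 < e ->
  exists2 d, 0 < d & forall z, `|Re z - x| < d -> 0 < Im z < d ->
    `|Im (cauchy_transform nu z) + pi * psi x| < e.
Proof.
move=> e0; have [cpsi psi0 nuE] := Hpsi.
have pi0 : 0 < pi :> R := pi_gt0 R.
have [d d0 Hd] := continuous_eps (cpsi x) (divr_gt0 e0 (mulr_gt0 (ltr0n _ 4) pi0)).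
have e1 : 0 < e / (8 * (psi x + 1)) by rewrite divr_gt0 // mulr_gt0 // ltr_pwDr.
have /cvgrPdist_lt /(_ _ e1) [A [_ HA]] := @cvgy_atan R.
(* The point Re z stays within D of x, hence at distance at least D from the
   complement of [x - 2D, x + 2D]. *)
pose D := d / 3; have D0 : 0 < D by rewrite divr_gt0.
have A1 : 0 < `|A| + 1 by rewrite ltr_pwDr.
exists (Num.min D (Num.min (D / (`|A| + 1)) (D ^+ 2 * (e / 4)))).
  by rewrite !lt_min D0 divr_gt0 //= mulr_gt0 ?exprn_gt0 // divr_gt0.
move=> z; rewrite !lt_min => /andP[zx _] /andP[z0 /andP[_ /andP[zA ze]]].
pose a := x - 2 * D; pose b := x + 2 * D.
have ab : a < b by rewrite /a /b; lra.
have := zx; rewrite ltr_norml => /andP[zx1 zx2].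
have zab : a + D <= Re z <= b - D by rewrite /a /b; lra.
have itv t : a <= t <= b -> psi x - e / (4 * pi) <= psi t <= psi x + e / (4 * pi).
  move=> tab; have : `|t - x| < d by rewrite ltr_norml; move: tab; rewrite /a /b /D; lra.
  by move/Hd; rewrite ltr_norml; lra.
have /andP[n1 n2] := near_part_bounds z0 ab itv.
have /andP[f1 f2] := far_part_bounds z0 D0 zab.
have f3 : Im z / D ^+ 2 < e / 4 by rewrite ltr_pdivrMr ?exprn_gt0 // mulrC.
rewrite Im_cauchy // -(setvU `[a, b]%classic) Rintegral_setU //; last 3 first.
- exact: measurableC.
- by rewrite setvU; exact: poisson_integrable.
- by rewrite disj_set_sym; apply/disj_setPS => t [].
move: n1 n2; set Q := atan _ - atan _ => n1 n2.
set N := \int[nu]_(x in [set` _]) _ in n1 n2 *.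
set F := \int[nu]_(x in ~` _) _ in f1 f2 *.
have AD : `|A| + 1 < D / Im z by rewrite ltr_pdivlMr // mulrC -ltr_pdivlMr.
have AA : A < `|A| + 1 by rewrite (le_lt_trans (ler_norm A)) // ltrDl.
have q1 : D / Im z <= (b - Re z) / Im z.
  by rewrite ler_pM2r ?invr_gt0 //; move: zab; lra.
have q2 : D / Im z <= - ((a - Re z) / Im z).
  by rewrite -mulNr ler_pM2r ?invr_gt0 //; move: zab; lra.
have Q1 : Q <= pi.
  have := atan_ltpi2 ((b - Re z) / Im z); have := atan_gtNpi2 ((a - Re z) / Im z).
  by rewrite /Q; lra.
have Q2 : pi - Q < 2 * (e / (8 * (psi x + 1))).
  have Ha := HA _ (lt_le_trans (lt_trans AA AD) q1).
  have Hb := HA _ (lt_le_trans (lt_trans AA AD) q2).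
  move: Ha Hb; rewrite /= atanN !ltr_norml /Q; lra.
have Q3 : psi x * (pi - Q) <= e / 4.
  have e8 : (psi x + 1) * (2 * (e / (8 * (psi x + 1)))) = e / 4.
    by field; rewrite gt_eqF // ltr_pwDr.
  rewrite -e8; have := psi0 x; nra.
have e4 : e / (4 * pi) * pi = e / 4 by rewrite invfM mulrA mulfVK // gt_eqF.
have e40 : 0 < e / (4 * pi) by rewrite divr_gt0 // mulr_gt0.
have psx := psi0 x.
have h1 : 0 <= psi x * (pi - Q) by rewrite mulr_ge0 // subr_ge0.
have h2 : 0 <= e / (4 * pi) * (pi - Q) by rewrite mulr_ge0 ?(ltW e40) // subr_ge0.
move: (e / (4 * pi)) e4 n1 n2 h2 => e' e4 n1 n2 h2.
by rewrite ltr_norml; apply/andP; split; lra.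
Qed.

End Boundary.

(** * The functional equation of F *)

Section FunctionalEquation.
Variables (R : realType).
Implicit Types (nu : probability (measurableTypeR R) R) (phi : R[i] -> R[i]) (z w : R[i]).

Lemma cauchy_neq0 nu z : 0 < Im z -> cauchy_transform nu z != 0.
Proof. by move=> z0; apply: Im_neq0; rewrite lt_eqF // Im_cauchy_lt0. Qed.

Lemma F_transform_upper nu z : 0 < Im z -> 0 < Im (F_transform nu z).
Proof.
move=> z0; rewrite /F_transform Im_inv -mulNr; have g0 := Im_cauchy_lt0 nu z0.
by rewrite divr_gt0 ?oppr_gt0 // ltr_wpDl ?sqr_ge0 // exprn_even_gt0 //= lt_eqF.
Qed.

Lemma jet2_F nu z : 0 < Im z -> jet2 (F_transform nu) z.
Proof.
move=> z0; apply: (@jet2_comp _ (cauchy_transform nu) (fun w => w^-1)).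
  by apply: jet2_cauchy; rewrite gt_eqF.
by apply: jet2_inv; exact: cauchy_neq0.
Qed.

(** Otherwise 1 / (w + phi w - z) would be at most 1/2 on the circle
    |w - z| = 3, but at least 1 at its centre. *)
Lemma fixed_point_near phi z :
  (forall w, cabs (w - z) <= 3 -> jet2 phi w /\ cabs (phi w) <= 1) ->
  exists2 w, cabs (w - z) <= 3 & w + phi w = z.
Proof.
move=> Hphi; apply/not_exists2P => Hw.
have {}Hw w : cabs (w - z) <= 3 -> w + phi w - z != 0.
  by move=> wz; apply/eqP => /subr0_eq E; have [] := Hw w.
have z3 : cabs (z - z) <= 3 by rewrite subrr cabs0.
pose g w := (w + phi w - z)^-1.
have gz : cabs (g z) <= 2^-1.
  apply: (@max_principle _ g z (-1) 3) => [|w /andP[_ wz]|w [w1|w3]|].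
  - by rewrite invr_ge0.
  - have [jphi _] := Hphi w wz.
    apply: (@jet2_comp _ (fun w => w + phi w - z) (fun w => w^-1)).
      apply: jet2_add; last exact: jet2_cst.
      by apply: jet2_add => //; exact: jet2_id.
    by apply: jet2_inv; exact: Hw.
  - by have := cabs_ge0 (w - z); rewrite w1; lra.
  - have wz : cabs (w - z) <= 3 by rewrite w3.
    have [_ p1] := Hphi w wz.
    have : 2 <= cabs (w + phi w - z).
      have := ler_cabs_sub (w - z) (- phi w); rewrite normcN opprK.
      by rewrite addrAC; lra.
    move=> h; rewrite Normc.normcV lef_pV2 ?posrE // cabs_gt0; exact: Hw.
  - by rewrite z3 andbT (le_trans _ (cabs_ge0 _)) // lerN10.
have [_ p1] := Hphi z z3.
move: gz; rewrite /g addrAC subrr add0r Normc.normcV.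
have := Hw z z3; rewrite addrAC subrr add0r -cabs_gt0 => p0.
by rewrite lef_pV2 ?posrE //; lra.
Qed.

(** The hypothesis gives F (w + phi w) = w near infinity. For z near iM, the
    solution w of w + phi w = z stays in the cone where this holds, so F z = w;
    the equation extends to the half-plane by [identity_upper]. *)
Lemma F_functional_equation nu phi :
  (forall z, 0 < Im z -> jet2 phi z) ->
  (forall z, 0 < Im z -> 1 <= cabs z -> cabs (phi z) <= 1) ->
  is_voiculescu_transform nu phi ->
  forall z, 0 < Im z -> F_transform nu z + phi (F_transform nu z) = z.
Proof.
move=> Jphi phi1 /(_ 1 ltr01)[M0 M00 [H [_ _ FH _] HE]] z z0.
apply/subr0_eq; move: z z0.
apply: (@identity_upper _ (fun z => F_transform nu z + phi (F_transform nu z) - z)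
   (M0 + 10)) => [z z0|M MM0].
  apply: jet2_add; last by apply: jet2_opp; exact: jet2_id.
  apply: jet2_add; first exact: jet2_F.
  apply: (@jet2_comp _ (F_transform nu) phi); first exact: jet2_F.
  by apply: Jphi; exact: F_transform_upper.
exists 1 => // z zM.
have near w : cabs (w - z) <= 3 -> M - 4 <= Im w /\ `|Re w| <= 4.
  move=> wz; have := Im_le_cabs (w - z); have := Im_le_cabs (z - 0 +i* M).
  have := Re_le_cabs (w - z); have := Re_le_cabs (z - 0 +i* M).
  by rewrite !ReImE /= subr0 !ler_norml => /andP[? ?] /andP[? ?] /andP[? ?] /andP[? ?];
    split; [|apply/andP; split]; lra.
have [w wz wE] : exists2 w, cabs (w - z) <= 3 & w + phi w = z.
  apply: fixed_point_near => w /near[w1 w2].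
  have w0 : 0 < Im w by lra.
  split; first exact: Jphi.
  by apply: phi1 => //; rewrite (le_trans _ (Im_le_cabs w)) // ger0_norm; lra.
have [w1 w2] := near w wz.
have wG : Gamma 1 M0 w by split; rewrite /= ?mul1r; [lra|rewrite (le_lt_trans w2) //; lra].
have Fz : F_transform nu z = w.
  by rewrite -[RHS](FH w wG); congr F_transform; rewrite -wE HE //; ring.
by rewrite Fz wE subrr.
Qed.

End FunctionalEquation.

(** * Stable laws and the duality of their Cauchy transforms *)

Section StableLaws.
Variables (R : realType) (alpha rho : R).
Hypotheses (alpha12 : 1 < alpha < 2) (rho01 : 0 <= rho <= 1).
Variable nu : probability (measurableTypeR R) R.
Hypothesis nu_stable : is_free_stable alpha rho nu.
Implicit Types z w : R[i].

Local Notation F := (F_transform nu).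
Local Notation G := (cauchy_transform nu).

Let c : R[i] := cexp (0 +i* ((alpha - 2) * rho * pi)).

Let cabs_c : cabs c = 1. Proof. by rewrite cabs_cexp expR0. Qed.

Lemma stableE z : stable_voiculescu alpha rho z = c * cpow z (1 - alpha).
Proof. by rewrite /stable_voiculescu; case/andP: alpha12 => ->. Qed.

Lemma stable_equation z : 0 < Im z -> F z + c * cpow (F z) (1 - alpha) = z.
Proof.
move=> z0; rewrite -stableE; move: z z0.
have [a1 a2] := andP alpha12.
apply: F_functional_equation nu_stable => z z0.
  have [a [b H]] : jet2 (fun w => c * cpow w (1 - alpha)) z.
    by apply: jet2_mul; [exact: jet2_cst|exact: jet2_cpow].
  by exists a, b; apply: isO_ext H => h; rewrite !stableE.
move=> z1; rewrite stableE Normc.normcM cabs_c mul1r cabs_cpow -[leRHS]expR0 ler_expR.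
by rewrite mulr_le0_ge0 ?ln_ge0 //; lra.
Qed.

(** By the functional equation, |F|^(1 - alpha) <= |z| + |F|, so F cannot be
    small. *)
Lemma cauchy_bounded z (B : R) : 0 < Im z -> cabs z <= B ->
  cabs (G z) <= expR (ln (1 + B) / (alpha - 1)).
Proof.
move=> z0 zB; have [a1 a2] := andP alpha12.
have B0 : 0 <= B by rewrite (le_trans _ zB) ?cabs_ge0.
have F0 := F_transform_upper nu z0; have f0 := upper_cabs_gt0 F0.
have GE : G z = (F z)^-1 by rewrite /F_transform invrK.
rewrite GE Normc.normcV -[cabs (F z)]lnK ?posrE // -expRN ler_expR.
have lB : 0 <= ln (1 + B) by rewrite ln_ge0 // lerDl.
have [f1|f1] := leP 1 (cabs (F z)).
  by rewrite (@le_trans _ _ 0) ?oppr_le0 ?ln_ge0 // divr_ge0 // subr_ge0 ltW.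
rewrite ler_pdivlMr ?subr_gt0 //.
have E : c * cpow (F z) (1 - alpha) = z - F z by apply: (addrI (F z)); rewrite stable_equation // addrC subrK.
have : cabs (c * cpow (F z) (1 - alpha)) <= 1 + B.
  by rewrite E (le_trans (ler_cabsB _ _)) //; lra.
rewrite Normc.normcM cabs_c mul1r cabs_cpow.
rewrite -[leRHS]lnK ?posrE ?ltr_pwDl // ler_expR; nra.
Qed.

Variables alpha' rho' : R.
Hypotheses (alpha'E : alpha' = 1 / alpha) (rho'E : rho' = 1 - (2 - alpha) * rho).

Let alpha'01 : 0 < alpha' < 1.
Proof.
have [a1 a2] := andP alpha12.
by rewrite alpha'E div1r invr_gt0 invf_lt1 ?a1 ?andbT; lra.
Qed.

Let alphaM : alpha' * alpha = 1.
Proof. by rewrite alpha'E div1r mulVf //; case/andP: alpha12 => *; lra. Qed.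

Lemma lower_cpow z : 0 < Im z -> Im (cpow z (- alpha')) < 0.
Proof.
move=> z0; have /andP[t0 tpi] := Im_clog_itv z0; have /andP[a0 a1] := alpha'01.
rewrite /cpow Im_cexp !ReImE !mul0r addr0 !mulNr sinN mulrN oppr_lt0.
rewrite mulr_gt0 ?expR_gt0 // sin_gt0_pi //; apply/andP; split; first exact: mulr_gt0.
by rewrite (lt_trans _ tpi) // gtr_pMl.
Qed.

(** This is the point Z; it lies in the lower half-plane, where
    G Z = conj (1 / F (conj Z)). *)
Let Zr z : R[i] := cpow z (- alpha').
Let L z : R[i] := clog (F (conjc (Zr z))).

(** The logarithm of w = z / (1 - Z G(Z)), see [stable_inverse_at]. *)
Let X z : R[i] := clog z + alpha%:C * conjc (L z) + 0 +i* (rho' * pi).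

Lemma ZG_exp z : 0 < Im z ->
  Zr z * G (Zr z) = cexp ((- alpha')%:C * clog z - conjc (L z)).
Proof.
move=> z0; have Z0 := lower_cpow z0; have Z0' : 0 < Im (conjc (Zr z)).
  by rewrite cIm_conj oppr_gt0.
rewrite cexpD; congr (_ * _).
rewrite -[in LHS](conjcK (Zr z)) cauchy_conj ?gt_eqF // cexpN -conj_cexp -conjc_inv.
congr conjc; rewrite cexp_clog ?F_transform_upper //.
by rewrite /F_transform invrK.
Qed.

(** The conjugate of K (F (conj Z)) = conj Z, divided by conj F. *)
Lemma one_sub_ZG z : 0 < Im z -> 1 - Zr z * G (Zr z) = cexp (clog z - X z).
Proof.
move=> z0; have Z0 := lower_cpow z0; have Z0' : 0 < Im (conjc (Zr z)).
  by rewrite cIm_conj oppr_gt0.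
have F0 := F_transform_upper nu Z0'.
have := congr1 conjc (stable_equation Z0'); rewrite conjcK /cpow -{1}(cexp_clog F0) -/(L z).
rewrite conjcD conj_cexp (conjcM c) !conj_cexp => E.
have EG : G (Zr z) = cexp (- conjc (L z)).
  by have := ZG_exp z0; rewrite cexpD => /(mulfI (cexp_neq0 _)).
rewrite EG -[X in X * _]E mulrDl -!cexpD.
rewrite subrr cexp0 opprD addrA subrr sub0r -[LHS]mulN1r.
have -> : (-1 : R[i]) = cexp (0 +i* (- pi)).
  by rewrite /cexp /= expR0 cosN sinN cospi sinpi oppr0; apply: complexP => /=; ring.
rewrite -cexpD; congr cexp; rewrite /X rho'E; move: (L z) => l.
apply: complexP; rewrite !ReImE /=; ring.
Qed.

(** Both logarithms in X have imaginary parts between 0 and pi, and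
    alpha - 1 <= rho' <= 1, so - pi < Im X < 2 pi and X is the principal
    logarithm of w. The equation is then 1 - exp (i alpha' rho' pi) w^(- alpha')
    = 1 - Z G(Z), where the exponents agree because alpha' alpha = 1. *)
Lemma stable_inverse_at z : 0 < Im z -> 0 < Im (z / (1 - Zr z * G (Zr z))) ->
  let w := z / (1 - Zr z * G (Zr z)) in
  w + stable_voiculescu alpha' rho' w = z.
Proof.
move=> z0 w0 w.
have wE : w = cexp (X z).
  by rewrite /w one_sub_ZG // -[X in X / _](cexp_clog z0) -cexpN -cexpD; congr cexp; ring.
have Z0 := lower_cpow z0; have Z0' : 0 < Im (conjc (Zr z)).
  by rewrite cIm_conj oppr_gt0.
have F0 := F_transform_upper nu Z0'.
have logw : clog w = X z.
  rewrite wE clog_cexp_wide // -?wE //.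
  have /andP[t0 t1] := Im_clog_itv z0; have /andP[l0 l1] := Im_clog_itv F0.
  have -> : Im (X z) = Im (clog z) - alpha * Im (L z) + rho' * pi.
    by rewrite /X; move: (L z) (clog z) => l k; rewrite !ReImE /=; ring.
  rewrite -/(L z) in l0 l1; have [a1 a2] := andP alpha12; have [r0 r1] := andP rho01.
  have /andP[r'0 r'1] : alpha - 1 <= rho' <= 1 by rewrite rho'E; nra.
  have p0 := pi_gt0 R; rewrite mulr2n; apply/andP; split; nra.
rewrite /stable_voiculescu ifN; last by rewrite -leNgt; have [_ /ltW] := andP alpha'01.
rewrite /cpow logw mulNr -cexpD.
have -> : 0 +i* (alpha' * rho' * pi) + (1 - alpha')%:C * X z =
    X z + ((- alpha')%:C * clog z - conjc (L z)).
  rewrite /X; move: (L z) (clog z) => l k.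
  have a1 := alphaM.
  apply: complexP; rewrite !ReImE /=.
    transitivity (Re k + alpha * Re l - alpha' * Re k - (alpha' * alpha) * Re l); first ring.
    by rewrite a1; ring.
  transitivity (Im k - alpha * Im l + rho' * pi - alpha' * Im k + (alpha' * alpha) * Im l); first ring.
  by rewrite a1; ring.
rewrite cexpD -ZG_exp // -wE -[w in X in X - _]mulr1 -mulrBr.
by rewrite /w divfK // one_sub_ZG // cexp_neq0.
Qed.

Variable nu' : probability (measurableTypeR R) R.
Hypothesis nu'_stable : is_free_stable alpha' rho' nu'.

(** G is bounded on the unit disc by [cauchy_bounded], and |Z| is at most
    1 / (10 C) when |z| is at least (10 C)^alpha. *)
Lemma ZG_small z : 0 < Im z ->
  expR (alpha * ln (10 * expR (ln (1 + 1) / (alpha - 1)))) <= cabs z ->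
  cabs (Zr z * G (Zr z)) <= 10^-1.
Proof.
set C := expR (ln (1 + 1) / _) => z0 zC.
have [a1 a2] := andP alpha12.
have C1 : 1 <= C.
  by rewrite -expR0 ler_expR divr_ge0 ?ln_ge0 //; lra.
have K0 : 0 < 10 * C by lra.
have Z0 := lower_cpow z0; have Z0' : 0 < Im (conjc (Zr z)).
  by rewrite cIm_conj oppr_gt0.
have ZK : cabs (Zr z) <= (10 * C)^-1.
  rewrite cabs_cpow -[leRHS]lnK ?posrE ?invr_gt0 // ler_expR lnV ?posrE //.
  rewrite mulNr lerN2 (_ : ln _ = alpha' * (alpha * ln (10 * C))); last first.
    by rewrite mulrA alphaM mul1r.
  rewrite ler_pM2l; last by case/andP: alpha'01.
  by rewrite -[leLHS]expRK ler_ln ?posrE ?expR_gt0 ?upper_cabs_gt0.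
have ZG : cabs (G (Zr z)) <= C.
  rewrite -cabs_conj -cauchy_conj ?lt_eqF //; apply: cauchy_bounded => //.
  by rewrite cabs_conj (le_trans ZK) // invf_le1 //; lra.
rewrite Normc.normcM (le_trans (ler_pM (cabs_ge0 _) (cabs_ge0 _) ZK ZG)) //.
by rewrite invfM mulfVK // gt_eqF //; lra.
Qed.

(** Near iM, Z G(Z) is at most 1/10 in modulus, so w = z / (1 - Z G(Z)) is within
    (M + 1) / 9 of z and lies in the cone where F' inverts K'. *)
Lemma cauchy_relation z : 0 < Im z ->
  cauchy_transform nu' z = (1 - Zr z * G (Zr z)) * z^-1.
Proof.
move=> z0; apply/subr0_eq; move: z z0.
have [M0 M00 [H [_ _ FH _] HE]] := nu'_stable ltr01.
pose M1 := expR (alpha * ln (10 * expR (ln (1 + 1) / (alpha - 1)))).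
apply: (@identity_upper _ (fun z => cauchy_transform nu' z - (1 - Zr z * G (Zr z)) * z^-1)
   (Num.max (M0 *+ 2 + 10) (M1 + 1))) => [z z0|M].
  have Z0 := lower_cpow z0.
  apply: jet2_add; first by apply: jet2_cauchy; rewrite gt_eqF.
  apply: jet2_opp; apply: jet2_mul; last by apply: jet2_inv; exact: upper_neq0.
  apply: jet2_add; first exact: jet2_cst.
  apply: jet2_opp; apply: jet2_mul; first exact: jet2_cpow.
  apply: (@jet2_comp _ Zr G); first exact: jet2_cpow.
  by apply: jet2_cauchy; rewrite lt_eqF.
rewrite ge_max mulr2n => /andP[MM0 MM1].
exists 1 => // z zM.
have zM' := ltW zM.
have := Re_le_cabs (z - 0 +i* M); have := Im_le_cabs (z - 0 +i* M).
rewrite !ReImE /= subr0 ler_norml => /andP[i1 i2] r1.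
have z0 : 0 < Im z by lra.
have zn := upper_neq0 z0.
have zlo : M - 1 <= cabs z by have := Im_le_cabs z; rewrite gtr0_norm //; lra.
have zhi : cabs z <= M + 1.
  have := le_normcD (z - 0 +i* M) (0 +i* M); rewrite subrK.
  have : cabs (0 +i* M) <= M by rewrite (le_trans (cabs_le_ReIm _)) //= normr0 add0r gtr0_norm //; lra.
  by lra.
have q10 : cabs (Zr z * G (Zr z)) <= 10^-1 by apply: ZG_small => //; rewrite -/M1; lra.
pose q := Zr z * G (Zr z); rewrite -/q in q10 *.
have q1 : 9 / 10 <= cabs (1 - q).
  by have := ler_cabs_sub 1 q; rewrite Normc.normc1; lra.
have qn : 1 - q != 0 by rewrite -cabs_gt0; lra.
pose w := z / (1 - q).
have wz : cabs (w - z) <= (M + 1) / 9.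
  have -> : w - z = z * q / (1 - q) by rewrite /w; field; exact: qn.
  rewrite (Normc.normcM _ (1 - q)^-1) (Normc.normcM z q) Normc.normcV ler_pdivrMr; last by lra.
  have := ler_pM (cabs_ge0 _) (cabs_ge0 _) zhi q10; nra.
have := Re_le_cabs (w - z); have := Im_le_cabs (w - z).
rewrite !(cReD w, cReN z, cImD w, cImN z) !ler_norml => /andP[i3 i4] /andP[r3 r4].
move: r1; rewrite ler_norml => /andP[r1 r2].
have w0 : 0 < Im w by lra.
have wG : Gamma 1 M0 w.
  by split; rewrite /= ?mul1r; [lra|rewrite ltr_norml; apply/andP; split; lra].
have Hw : H w = z.
  have := stable_inverse_at z0; rewrite -/q -/w => /(_ w0) <-.
  by rewrite HE //; ring.
have := FH w wG; rewrite Hw /F_transform => /(congr1 (fun u => u^-1)); rewrite invrK => ->.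
by rewrite /w invfM invrK mulrC subrr.
Qed.

End StableLaws.

(** * Passage to the boundary *)

Section BoundaryValues.
Variable R : realType.

Lemma cos_scale_cvg (k : R) : cos (k * a) @[a --> 0^'+] --> (1 : R).
Proof.
apply: cvg_at_right_filter; rewrite -[X in _ --> X](cos0 R) -[X in cos X](mulr0 k).
apply: continuous_comp; first exact: mulrl_continuous.
exact: continuous_cos.
Qed.

Lemma sin_scale_cvg (k : R) : sin (k * a) @[a --> 0^'+] --> (0 : R).
Proof.
apply: cvg_at_right_filter; rewrite -[X in _ --> X](sin0 R) -[X in sin X](mulr0 k).
apply: continuous_comp; first exact: mulrl_continuous.
exact: continuous_sin.
Qed.

Lemma cvg0_mul_bounded (f g : R -> R) (C : R) :
  f a @[a --> 0^'+] --> (0 : R) -> (\forall a \near 0^'+, `|g a| <= C) ->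
  f a * g a @[a --> 0^'+] --> (0 : R).
Proof.
move=> f0 gC; apply/cvgrPdist_lt => e e0.
have C1 : 0 < `|C| + 1 by rewrite ltr_pwDr.
have /cvgrPdist_lt /(_ _ (divr_gt0 e0 C1)) f1 := f0.
near=> a.
have fa : `|0 - f a| < e / (`|C| + 1) by near: a; exact: f1.
have ga : `|g a| <= C by near: a; exact: gC.
rewrite sub0r normrN normrM; rewrite sub0r normrN ltr_pdivlMr // in fa.
rewrite (le_lt_trans _ fa) // ler_wpM2l // (le_trans ga) //.
by rewrite (le_trans (ler_norm _)) // lerDl.
Unshelve. all: by end_near. Qed.

Definition ray (r k a : R) : R[i] := cexp (ln r +i* (k * a)).

Lemma Re_ray r k a : 0 < r -> Re (ray r k a) = r * cos (k * a).
Proof. by move=> r0; rewrite Re_cexp /= lnK. Qed.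

Lemma Im_ray r k a : 0 < r -> Im (ray r k a) = r * sin (k * a).
Proof. by move=> r0; rewrite Im_cexp /= lnK. Qed.

Lemma Im_ray_gt0 (r k a : R) : 0 < r -> 0 < k <= 1 -> 0 < a < pi -> 0 < Im (ray r k a).
Proof.
move=> r0 /andP[k0 k1] /andP[a0 api]; rewrite Im_ray // mulr_gt0 // sin_gt0_pi //.
by rewrite mulr_gt0 //= (le_lt_trans _ api) // ler_piMl // ltW.
Qed.

(** The ray of argument k a through r turns onto the real axis at r as a tends
    to 0. *)
Lemma cauchy_ray_cvg nu (psi : R -> R) (r k : R) : is_continuous_density nu psi ->
  0 < r -> 0 < k <= 1 ->
  Im (cauchy_transform nu (ray r k a)) @[a --> 0^'+] --> - (pi * psi r).
Proof.
move=> Hpsi r0 k01; apply/cvgrPdist_lt => e e0.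
have [d d0 Hd] := stieltjes_inversion Hpsi r e0.
have dr : 0 < d / r by rewrite divr_gt0.
have /cvgrPdist_lt /(_ _ dr) c1 := cos_scale_cvg k.
have /cvgrPdist_lt /(_ _ dr) s1 := sin_scale_cvg k.
near=> a.
have ca : `|1 - cos (k * a)| < d / r by near: a.
have sa : `|0 - sin (k * a)| < d / r by near: a.
have a0 : 0 < a by near: a; exact: nbhs_right_gt.
have api : a < pi by near: a; apply: nbhs_right_lt; exact: pi_gt0.
have z0 : 0 < Im (ray r k a) by rewrite Im_ray_gt0 // a0.
rewrite distrC opprK; apply: Hd.
  rewrite Re_ray // -{2}[r]mulr1 -mulrBr normrM gtr0_norm // distrC.
  by rewrite mulrC -ltr_pdivlMr.
rewrite z0 Im_ray // mulrC -ltr_pdivlMr // (le_lt_trans (ler_norm _)) //.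
by move: sa; rewrite sub0r normrN.
Unshelve. all: by end_near. Qed.

End BoundaryValues.

Theorem propositionA3p1 (R : realType) (alpha rho : R)
    (halpha : 1 < alpha < 2) (hrho : 0 <= rho <= 1)
    (alpha' rho' : R) (halpha' : alpha' = 1 / alpha)
    (hrho' : rho' = 1 - (2 - alpha) * rho)
    (nu nu' : probability (measurableTypeR R) R) (psi psi' : R -> R)
    (hnu : is_free_stable alpha rho nu)
    (hpsi : is_continuous_density nu psi)
    (hnu' : is_free_stable alpha' rho' nu')
    (hpsi' : is_continuous_density nu' psi') :
  forall x : R, 0 < x ->
    psi x = x `^ (- 1 - alpha) * psi' (x `^ (- alpha)).
Proof.
move=> x x0; pose x' := x `^ (- alpha).
have [a1 a2] := andP halpha.
have x'0 : 0 < x' by rewrite powR_gt0.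
have k01 : 0 < alpha' <= 1 by rewrite halpha' div1r invr_gt0 invf_le1 ?(ltW a1) ?andbT; lra.
have k11 : 0 < (1 : R) <= 1 by rewrite ltr01 lexx.
have lnx' : ln x' = - alpha * ln x by rewrite ln_powR.
pose g a := cauchy_transform nu (ray x alpha' a).
have lim_g : Im (g a) @[a --> 0^'+] --> - (pi * psi x) := cauchy_ray_cvg hpsi x0 k01.
have lim_g' := cauchy_ray_cvg hpsi' x'0 k11.
have gC : \forall a \near 0^'+, `|Re (g a)| <= expR (ln (1 + x) / (alpha - 1)).
  near=> a.
  have a0 : 0 < a by near: a; exact: nbhs_right_gt.
  have api : a < pi by near: a; apply: nbhs_right_lt; exact: pi_gt0.
  rewrite (le_trans (Re_le_cabs _)) //; apply: (cauchy_bounded halpha hnu).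
    by rewrite Im_ray_gt0 // a0.
  by rewrite cabs_cexp /= lnK.
have c1 := cos_scale_cvg (1 : R); have s1 := sin_scale_cvg (1 : R).
have ck := cos_scale_cvg alpha'; have sk := sin_scale_cvg alpha'.
have s1g := cvg0_mul_bounded s1 gC; have skg := cvg0_mul_bounded sk gC.
(* The imaginary part of (1 - Z G(Z)) / z for z = x' e^(ia), in terms of
   g = G (conj Z) and conj Z = x e^(i alpha' a). *)
pose v a := x'^-1 * (cos (1 * a) * (x * (cos (alpha' * a) * Im (g a) + sin (alpha' * a) * Re (g a)))
  - (sin (1 * a) - x * (cos (alpha' * a) * (sin (1 * a) * Re (g a)))
     + x * (sin (1 * a) * (sin (alpha' * a) * Im (g a))))).
have lim_v : v a @[a --> 0^'+] --> x'^-1 * (1 * (x * (1 * - (pi * psi x) + 0))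
  - (0 - x * (1 * 0) + x * (0 * (0 * - (pi * psi x))))).
  apply: cvgM; first exact: cvg_cst.
  apply: cvgB.
    apply: cvgM => //; apply: cvgM; first exact: cvg_cst.
    by apply: cvgD => //; exact: cvgM.
  apply: cvgD.
    apply: cvgB => //; apply: cvgM; first exact: cvg_cst.
    exact: cvgM.
  apply: cvgM; first exact: cvg_cst.
  by apply: cvgM => //; exact: cvgM.
have E : \forall a \near 0^'+, Im (cauchy_transform nu' (ray x' 1 a)) = v a.
  near=> a.
  have a0 : 0 < a by near: a; exact: nbhs_right_gt.
  have api : a < pi by near: a; apply: nbhs_right_lt; exact: pi_gt0.
  have z'0 : 0 < Im (ray x' 1 a) by rewrite Im_ray_gt0 // a0.
  have z0 : 0 < Im (ray x alpha' a) by rewrite Im_ray_gt0 // a0.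
  have Zr : cpow (ray x' 1 a) (- alpha') = conjc (ray x alpha' a).
    rewrite /cpow /ray clog_cexp; last by rewrite /= mul1r a0.
    rewrite conj_cexp lnx'; congr cexp.
    have kM : alpha' * alpha = 1 by rewrite halpha' div1r mulVf //; lra.
    apply: complexP; rewrite !ReImE /=; last by ring.
    by rewrite mul0r subr0 mulrA mulrNN kM mul1r.
  rewrite (cauchy_relation halpha hrho hnu halpha' hrho' hnu') // Zr.
  rewrite cauchy_conj ?gt_eqF // -/(g a) -cexpN.
  rewrite cImM Im_cexp Re_cexp cReD cImD !cReN !cImN.
  rewrite (cReM (conjc (ray _ _ _))) (cImM (conjc (ray _ _ _))).
  rewrite (cRe_conj (g a)) (cIm_conj (g a)) (cRe_conj (ray _ _ _)) (cIm_conj (ray _ _ _)).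
  rewrite Re_ray // Im_ray // cRe1 cIm1 /v; move: (Re (g a)) (Im (g a)) => gr gi.
  rewrite /= expRN lnK // cosN sinN.
  by ring.
have lim_v' : v a @[a --> 0^'+] --> - (pi * psi' x').
  exact: cvg_trans (near_eq_cvg E) lim_g'.
have := cvg_unique _ lim_v lim_v'.
rewrite !(mul1r, mul0r, mulr0, addr0, subr0) => /(_ (@Rhausdorff R)) lim_eq.
have -> : x `^ (- 1 - alpha) = x^-1 * x'.
  by rewrite powRD ?powR_inv1 ?(ltW x0) // [x == 0]gt_eqF // implybT.
have pi0 : (pi : R) != 0 by rewrite gt_eqF // pi_gt0.
apply: (mulfI pi0); rewrite -[LHS]opprK -[RHS]opprK; congr (- _).
rewrite [RHS](_ : _ = x^-1 * (x' * - (pi * psi' x'))); last by ring.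
by rewrite -lim_eq; field; rewrite !gt_eqF.
Unshelve. all: by end_near. Qed.
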